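(* Let $\alpha>0$ and let $r\in C(0,+\infty)$ satisfy $r(x)>0$ for all $x>0$, $\int_0^1\frac{d\tau}{r(\tau)}=+\infty$ and $\int_1^\infty\frac{d\tau}{r(\tau)}=+\infty$. Let $X(y,t)$ ($t>0$, $y>0$) be defined by $\int_{X(y,t)}^y\frac{1}{r(\tau)}d\tau=t$. Then $$(U_0(t)f)(y):=\frac{r(X(y,t))f(X(y,t))}{r(y)}=f(X(y,t))\frac{\partial X(y,t)}{\partial y}$$ defines a positive $C_0$-semigroup $(U_0(t))_{t\ge0}$ on $X_{0,\alpha}$ if and only if $$\sup_{x>0}\frac{1+y(x,t)}{1+x}<+\infty\quad(t\ge0)$$ and $[0,+\infty)\ni t\mapsto\sup_{x>0}\frac{1+y(x,t)}{1+x}$ is locally bounded, where $y(x,t)\ge x$ is defined by $\int_x^{y(x,t)}\frac{1}{r(\tau)}d\tau=t$. In this case $$\|U_0(t)\|_{\mathcal{L}(X_{0,\alpha})}=\sup_{x>0}\frac{(1+y(x,t))^\alpha}{(1+x)^\alpha}.$$ This occurs if $\sup_{z>1}\frac{r(z)}{z}<+\infty$.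
   Context: $X_{0,\alpha}:=L^1(\mathbb{R}_+;(1+x)^\alpha dx)$ with $\mathbb{R}_+=(0,+\infty)$. For $t>0$, $X(y,t)\in(0,y)$; for $t=0$, $X(y,0)=y$, so $U_0(0)$ is the identity. *)

(* Defs.v *)
From HB Require Import structures.
From mathcomp Require Import all_boot all_order all_algebra.
From mathcomp Require Import all_classical all_reals all_analysis.
From mathcomp Require Import measurable_realfun.

Set Implicit Arguments.
Unset Strict Implicit.
Unset Printing Implicit Defensive.

Import Order.TTheory GRing.Theory Num.Theory.
Import numFieldTopology.Exports numFieldNormedType.Exports.

Local Open Scope classical_set_scope.
Local Open Scope ring_scope.

(* The library type [LspaceType1 mu] (classes of measurable functions modulo
   a.e. equality, with finite L^1 norm) carries no algebraic structure; we make
   it a normed module. *)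
Section L1_normed_module.
Context d (T : measurableType d) (R : realType).
Variable mu : {measure set T -> \bar R}.

Local Notation Lf := (LfunType mu (@lexx _ _ 1%E)).
Local Notation L1 := (LspaceType1 mu).

Definition L1_rep (u : L1) : T -> R := aqEqMfun_to_fun (LebesgueSpace.sort u).

Lemma L1_rep_Lfun (u : L1) : L1_rep u \in Lfun mu 1.
Proof.
rewrite inE; apply/andP; split; rewrite inE/=; last exact: Lebesgue_finite.
exact: (@measurable_funPT _ _ _ _ (repr (LebesgueSpace.sort u))).
Qed.

Definition L1_fun (u : L1) : Lf := Lfun_Sub (@lexx _ _ 1%E) (L1_rep_Lfun u).

Lemma L1_funE (u : L1) : (L1_fun u : T -> R) = L1_rep u.
Proof. by []. Qed.

Local Open Scope quotient_scope.

(* [LspaceType] is built over [measurableTypeR R], whereas [LfunType] uses [R]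
   itself: the same sigma-algebra, but with another display. *)
Lemma L1_mfun_subproof (f : Lf) :
  measurable_fun [set: T] ((f : T -> R) : T -> measurableTypeR R).
Proof. exact: (@measurable_funPT _ _ _ _ f). Qed.

Definition L1_mfun (f : Lf) : {mfun T >-> measurableTypeR R} :=
  @MeasurableFun.Pack _ _ _ (measurableTypeR R) (f : T -> R)
    (@MeasurableFun.Class _ _ _ (measurableTypeR R) _
       (@isMeasurableFun.Build _ _ T (measurableTypeR R) _
          (L1_mfun_subproof f))).

Definition L1_mclass (f : Lf) : {mfun_ mu, T >-> measurableTypeR R} :=
  \pi_({mfun_ mu, T >-> measurableTypeR R}) (L1_mfun f).

Lemma L1_mclass_ae (f : Lf) :
  (aqEqMfun_to_fun (L1_mclass f) : T -> R) = f %[ae mu].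
Proof.
have : repr (L1_mclass f) = L1_mfun f
    %[mod {mfun_ mu, T >-> measurableTypeR R}].
  by rewrite reprK.
by move=> /eqP; rewrite eqmodE => /asboolP.
Qed.

Lemma L1_norm_ae (f g : T -> R) :
  measurable_fun setT f -> measurable_fun setT g -> f = g %[ae mu] ->
  ('N[mu]_1[EFin \o f] = 'N[mu]_1[EFin \o g])%E.
Proof.
move=> mf mg fg; rewrite !Lnorm1.
apply: ae_eq_integral => //.
- by apply: measurableT_comp => //; exact/measurable_EFinP.
- by apply: measurableT_comp => //; exact/measurable_EFinP.
by apply: filterS fg => x /= fgx xT; rewrite fgx.
Qed.

Lemma L1_mclass_finite (f : Lf) :
  finite_norm mu 1 (aqEqMfun_to_fun (L1_mclass f) : T -> R).
Proof.
rewrite /finite_norm (@L1_norm_ae _ f).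
- exact: Lfunction_finite.
- exact: (@measurable_funPT _ _ _ _ (repr (L1_mclass f))).
- exact: (@measurable_funPT _ _ _ _ f).
- exact: L1_mclass_ae.
Qed.

(* The class in L^1 of an integrable function. *)
Definition L1_class (f : Lf) : L1 :=
  @LebesgueSpace.Pack _ _ _ _ _ (@lexx _ _ 1%E) (L1_mclass f)
    (@LebesgueSpace.Class _ _ _ _ _ _ _
       (@isFinLebesgue.Build _ _ _ mu _ (@lexx _ _ 1%E) _ (L1_mclass_finite f))).

Lemma L1_classE (f : Lf) : L1_rep (L1_class f) = f %[ae mu].
Proof. exact: L1_mclass_ae. Qed.

Lemma L1_ext (u v : L1) : L1_rep u = L1_rep v %[ae mu] -> u = v.
Proof.
case: u v => [u [[pu]]] [v [[pv]]] uv.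
have {}uv : u = v.
  have /eqP : u == v %[mod {mfun_ mu, T >-> measurableTypeR R}].
    exact/ae_eqP.
  by rewrite !reprK.
by subst v; rewrite (Prop_irrelevance pu pv).
Qed.

HB.instance Definition _ := gen_eqMixin L1.
HB.instance Definition _ := gen_choiceMixin L1.

Definition L1_zero : L1 := L1_class 0.
Definition L1_add (u v : L1) : L1 := L1_class (L1_fun u + L1_fun v).
Definition L1_opp (u : L1) : L1 := L1_class (- L1_fun u).
Definition L1_scale (a : R) (u : L1) : L1 := L1_class (a *: L1_fun u).

Lemma L1_zeroE : L1_rep L1_zero = (fun=> 0) %[ae mu].
Proof. exact: L1_classE. Qed.
Lemma L1_addE (u v : L1) :
  L1_rep (L1_add u v) = (fun x => L1_rep u x + L1_rep v x) %[ae mu].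
Proof. exact: L1_classE. Qed.
Lemma L1_oppE (u : L1) :
  L1_rep (L1_opp u) = (fun x => - L1_rep u x) %[ae mu].
Proof. exact: L1_classE. Qed.
Lemma L1_scaleE (a : R) (u : L1) :
  L1_rep (L1_scale a u) = (fun x => a * L1_rep u x) %[ae mu].
Proof. exact: L1_classE. Qed.

Let addA : associative L1_add.
Proof.
move=> u v w; apply: L1_ext.
apply: filterS2 (filterI (L1_addE u (L1_add v w)) (L1_addE v w))
  (filterI (L1_addE (L1_add u v) w) (L1_addE u v)) => x [h1 h2] [h3 h4] xT.
by rewrite h1// h2// h3// h4// addrA.
Qed.

Let addC : commutative L1_add.
Proof.
move=> u v; apply: L1_ext.
move: (L1_addE u v) (L1_addE v u); apply: filterS2 => x h1 h2 xT.
by rewrite h1// h2// addrC.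
Qed.

Let add0 : left_id L1_zero L1_add.
Proof.
move=> u; apply: L1_ext.
move: (L1_addE L1_zero u) L1_zeroE; apply: filterS2 => x h1 h2 xT.
by rewrite h1// h2// add0r.
Qed.

Let addN : left_inverse L1_zero L1_opp L1_add.
Proof.
move=> u; apply: L1_ext.
move: (L1_addE (L1_opp u) u) L1_zeroE (L1_oppE u).
by apply: filterS3 => x h1 h2 h3 xT; rewrite h1// h2// h3// addNr.
Qed.

HB.instance Definition _ := GRing.isZmodule.Build L1 addA addC add0 addN.

Let scaleA (a b : R) (u : L1) :
  L1_scale a (L1_scale b u) = L1_scale (a * b) u.
Proof.
apply: L1_ext.
move: (L1_scaleE a (L1_scale b u)) (L1_scaleE b u) (L1_scaleE (a * b) u).
by apply: filterS3 => x h1 h2 h3 xT; rewrite h1// h2// h3// mulrA.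
Qed.

Let scale1 : left_id 1 L1_scale.
Proof.
move=> u; apply: L1_ext; move: (L1_scaleE 1 u).
by apply: filterS => x h1 xT; rewrite h1// mul1r.
Qed.

Let scaleDr : right_distributive L1_scale +%R.
Proof.
move=> a u v; apply: L1_ext.
apply: filterS3 (filterI (L1_scaleE a (L1_add u v)) (L1_addE u v))
  (L1_addE (L1_scale a u) (L1_scale a v))
  (filterI (L1_scaleE a u) (L1_scaleE a v)) => x [h1 h2] h3 [h4 h5] xT.
by rewrite h1// h2// h3// h4// h5// mulrDr.
Qed.

Let scaleDl (u : L1) : {morph L1_scale^~ u : a b / a + b}.
Proof.
move=> a b; apply: L1_ext.
apply: filterS3 (L1_scaleE (a + b) u) (L1_addE (L1_scale a u) (L1_scale b u))
  (filterI (L1_scaleE a u) (L1_scaleE b u)) => x h1 h2 [h3 h4] xT.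
by rewrite h1// h2// h3// h4// mulrDl.
Qed.

HB.instance Definition _ :=
  GRing.Zmodule_isLmodule.Build R L1 scaleA scale1 scaleDr scaleDl.

Definition L1_norm (u : L1) : R := fine 'N[mu]_1[EFin \o L1_rep u]%E.

Lemma L1_norm_class (f : Lf) :
  L1_norm (L1_class f) = fine 'N[mu]_1[EFin \o f]%E.
Proof.
rewrite /L1_norm; congr fine; apply: L1_norm_ae; last exact: L1_classE.
- exact: (@measurable_funPT _ _ _ _ (L1_fun (L1_class f))).
- exact: (@measurable_funPT _ _ _ _ f).
Qed.

Let normD (u v : L1) : L1_norm (u + v) <= L1_norm u + L1_norm v.
Proof. by rewrite [u + v]/(L1_add u v) L1_norm_class; exact: ler_LnormD. Qed.

Let normZ (a : R) (u : L1) : L1_norm (a *: u) = `|a| * L1_norm u.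
Proof.
rewrite [a *: u]/(L1_scale a u) L1_norm_class.
apply: EFin_inj; rewrite EFinM /L1_norm -L1_funE.
by rewrite finite_norm_fine (finite_norm_fine (L1_fun u)) LnormZ.
Qed.

Let norm0 (u : L1) : L1_norm u = 0 -> u = 0.
Proof.
move=> /(@fine_Lnormr_eq0 _ _ _ _ _ _ (L1_fun u)) u0.
apply: L1_ext; move: L1_zeroE u0.
by apply: filterS2 => x h1 h2 xT; rewrite h1//; exact: h2.
Qed.

HB.instance Definition _ := Lmodule_isNormed.Build R L1 normD normZ norm0.

Lemma L1_normE (u : L1) : `|u| = fine (\int[mu]_x `|(L1_rep u x)%:E|)%E.
Proof. by rewrite -Lnorm1. Qed.

End L1_normed_module.

Section C0_semigroup.
Context (R : realType) (V : normedModType R).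

(* A C_0-semigroup (U t)_{t >= 0} of bounded linear operators; the values of U
   at t < 0 are irrelevant. *)
Record C0_semigroup (U : R -> V -> V) : Prop := {
  C0_linear : forall t : R, 0 <= t -> linear (U t) ;
  C0_bounded : forall t : R, 0 <= t -> continuous (U t) ;
  C0_0 : U 0 = id ;
  C0_D : forall s t : R, 0 <= s -> 0 <= t -> U (s + t) = U s \o U t ;
  C0_strong : forall v, U t v @[t --> 0^'+] --> v }.

Definition opnorm (A : V -> V) : \bar R :=
  ereal_sup [set `|A v|%:E | v in [set v | `|v| <= 1]].

End C0_semigroup.

Definition L1_nneg d (T : measurableType d) (R : realType)
    (mu : {measure set T -> \bar R}) (u : LspaceType1 mu) : Prop :=
  {ae mu, forall x, 0 <= L1_rep u x}.

Definition positive_operator d (T : measurableType d) (R : realType)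
    (mu : {measure set T -> \bar R}) (A : LspaceType1 mu -> LspaceType1 mu) :=
  forall u, L1_nneg u -> L1_nneg (A u).

(* The measure (1 + x)^alpha dx on R_+ = (0, +oo), seen as a measure on R that
   vanishes on (-oo, 0]; thus functions on R_+ are represented by functions on
   R whose values outside R_+ do not matter. *)
Section weighted_measure.
Context (R : realType) (alpha : R).
Local Open Scope ereal_scope.

Definition weighted_measure (A : set (measurableTypeR R)) : \bar R :=
  \int[lebesgue_measure]_(x in A `&` `]0%R, +oo[) ((1 + x) `^ alpha)%:E.

Let weighted_measure0 : weighted_measure set0 = 0.
Proof. by rewrite /weighted_measure set0I integral_set0. Qed.

Let weighted_measure_ge0 A : 0 <= weighted_measure A.
Proof. by apply: integral_ge0 => x _; rewrite lee_fin powR_ge0. Qed.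

Let weighted_measure_sigma_additive : semi_sigma_additive weighted_measure.
Proof.
move=> /= F mF tF mUF; rewrite /weighted_measure; apply: cvg_toP.
  apply: ereal_nondecreasing_is_cvgn => m n mn.
  apply: lee_sum_nneg_natr => // k _ _; apply: integral_ge0 => /= x Fkx.
  by rewrite lee_fin powR_ge0.
rewrite setI_bigcupl ge0_integral_bigcup//=.
- by move=> k; exact: measurableI.
- apply/measurable_funTS/measurable_EFinP.
  apply: (measurableT_comp (measurable_powR alpha)).
  exact: measurable_funD.
- by move=> x _; rewrite lee_fin powR_ge0.
- by apply: trivIset_setIr.
Qed.

HB.instance Definition _ := isMeasure.Build _ _ _ weighted_measure
  weighted_measure0 weighted_measure_ge0 weighted_measure_sigma_additive.

End weighted_measure.

(* X_{0,alpha} = L^1(R_+; (1 + x)^alpha dx). *)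
Notation X0 alpha := (LspaceType1 (weighted_measure alpha)).

Section flow.
Context (R : realType) (r : R -> R).

(* The time \int_x^y dtau / r(tau). *)
Definition travel_time (x y : R) : \bar R :=
  (\int[lebesgue_measure]_(tau in `[x, y]) ((r tau)^-1)%:E)%E.

(* X(y,t): the x in (0,y] with \int_x^y dtau / r(tau) = t. As r > 0, x = y
   happens only for t = 0, and then X(y,0) = y. Here and in [flow_fwd], 0 is the
   default value if there is no such point. *)
Definition flow_back (y t : R) : R :=
  xget 0 [set x | 0 < x <= y /\ travel_time x y = t%:E].

(* y(x,t): the y >= x with \int_x^y dtau / r(tau) = t. *)
Definition flow_fwd (x t : R) : R :=
  xget 0 [set y | x <= y /\ travel_time x y = t%:E].

Definition U0 (t : R) (f : R -> R) (y : R) : R :=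
  r (flow_back y t) * f (flow_back y t) / r y.

Definition growth (t : R) : \bar R :=
  ereal_sup [set ((1 + flow_fwd x t) / (1 + x))%:E | x in `]0, +oo[].

Definition growth_condition : Prop :=
  (forall t : R, 0 <= t -> (growth t < +oo)%E) /\
  (forall t0 : R, 0 <= t0 ->
    bounded_near (fun t : R => fine (growth t)) (within `[0, +oo[ (nbhs t0))).

(* The operators U t on X_{0,alpha} are those given by the formula U0 t:
   whatever the representative f, U t maps the class of f to that of U0 t f. *)
Definition given_by_U0 (alpha : R) (U : R -> X0 alpha -> X0 alpha) : Prop :=
  forall t : R, 0 <= t ->
  forall f : LfunType (weighted_measure alpha) (@lexx _ _ 1%E),
  L1_rep (U t (L1_class f)) = U0 t f %[ae weighted_measure alpha].

Definition U0_positive_C0_semigroup (alpha : R)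
    (U : R -> X0 alpha -> X0 alpha) : Prop :=
  [/\ given_by_U0 U, C0_semigroup U &
      forall t : R, 0 <= t -> positive_operator (U t)].

End flow.

(* Main.v *)
From HB Require Import structures.
Require Import Defs.
From mathcomp Require Import all_boot all_order all_algebra.
From mathcomp Require Import all_classical all_reals all_analysis.
From mathcomp Require Import measurable_realfun ring lra.

(** Let T be a primitive of 1 / r on (0, +oo). It is increasing, and the two
    divergent integrals make it a bijection onto R; let S be its inverse. Below,
    T and S are called [clock] and [position]. In the variable T the flow is a
    translation: X(y,t) = S(T y - t) and y(x,t) = S(T x + t) ([flow_backE],
    [flow_fwdE]). The derivative of X in y and the law
    X(y,s+t) = X(X(y,s),t) can be read off from these formulas.

    T + c carries the measure dx / r(x) to the Lebesgue measure of R, for every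
    constant c ([integral_clock]). Comparing c = - t with c = 0, one sees that
    dx / r(x) is invariant under y |-> X(y,t) ([integral_flow_back]), whence
      int |U_0(t) f(y)| (1 + y)^alpha dy = int |f(x)| (1 + y(x,t))^alpha dx
    ([integral_U0_pos]). Relative to the weighted measure, the right-hand side
    integrates |f| against the ratio ((1 + y(x,t)) / (1 + x))^alpha, so the
    supremum of this ratio bounds the norm of U_0(t). The bound is approached by
    normalized indicators of [a, b] when b decreases to a, because y(x,t)
    increases with x ([weight_le_opnorm]). Hence any operator given by the
    formula for U_0(t) has this supremum as its norm ([opnormE]), which is
    finite exactly when [growth r t] is ([growth_lty]). Local boundedness of
    [growth r] comes with its finiteness, since y(x,t) increases with t and
    [growth r] is therefore nondecreasing ([growth_conditionP]).

    Conversely, suppose that [growth r] is finite. The norm identity, applied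
    to a difference, shows that U_0(t) acts on classes ([U0_pos_ae_eq]), and it
    bounds the resulting operators. For strong continuity at 0 it is enough,
    the norms being bounded for t <= 1, to treat a dense set, here the functions
    h 1_[a,b] with h continuous and 0 < a ([weighted_approximation]). Their
    images for t <= 1 vanish outside [a, y(b,1)] and are uniformly bounded, so
    dominated convergence applies ([U0_pos_patch_cvg]).

    Finally, if r(z) <= C z for z > 1, then C T - ln is nondecreasing there,
    so that y(x,t) <= max(x,1) e^(C t) when y(x,t) > 1
    ([growth_lty_of_linear_bound]). *)

Set Implicit Arguments.
Unset Strict Implicit.
Unset Printing Implicit Defensive.

Import Order.TTheory GRing.Theory Num.Theory.
Import numFieldTopology.Exports numFieldNormedType.Exports.

Local Open Scope classical_set_scope.
Local Open Scope ring_scope.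

(** * Measures with a density *)

Section density.
Context d (T : measurableType d) (R : realType).
Variables (mu : {measure set T -> \bar R}) (w : T -> \bar R).
Hypotheses (mw : measurable_fun setT w) (w0 : forall x, (0 <= w x)%E).
Local Open Scope ereal_scope.

(** The two proofs are arguments so that the measure structure can be inferred
    from the term. *)
Definition density of measurable_fun setT w & (forall x, 0 <= w x) :=
  fun A : set T => \int[mu]_(x in A) w x.

Let density0 : density mw w0 set0 = 0.
Proof. by rewrite /density integral_set0. Qed.

Let density_ge0 A : 0 <= density mw w0 A.
Proof. exact: integral_ge0. Qed.

Let density_sigma_additive : semi_sigma_additive (density mw w0).
Proof.
move=> /= F mF tF mUF; rewrite /density; apply: cvg_toP.
  apply: ereal_nondecreasing_is_cvgn => m n mn.
  by apply: lee_sum_nneg_natr => // k _ _; exact: integral_ge0.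
by rewrite ge0_integral_bigcup//; exact: measurable_funTS.
Qed.

HB.instance Definition _ := isMeasure.Build _ _ _ (density mw w0)
  density0 density_ge0 density_sigma_additive.

Import HBNNSimple.

(** By hypothesis the two sides agree on indicators, hence on simple functions
    and, by monotone convergence, on all nonnegative measurable functions. The
    measure [m] is arbitrary so as to cover both [density] and
    [weighted_measure]. *)
Lemma ge0_integral_density (m : {measure set T -> \bar R}) :
  (forall A, measurable A -> m A = \int[mu]_(x in A) w x) ->
  forall f, measurable_fun setT f -> (forall x, 0 <= f x) ->
  \int[m]_x f x = \int[mu]_x (f x * w x).
Proof.
move=> mE f mf f0; pose f_ := nnsfun_approx measurableT mf.
have fw0 n x : 0 <= (f_ n x)%:E * w x by rewrite mule_ge0// lee_fin.
have mfw n : measurable_fun setT (fun x => (f_ n x)%:E * w x).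
  by apply: emeasurable_funM => //; exact/measurable_EFinP.
have fw_nd x : {homo (fun n => (f_ n x)%:E * w x) : a b / (a <= b)%N >-> a <= b}.
  move=> a b ab; rewrite lee_wpmul2r// lee_fin.
  by move/lefP: (nd_nnsfun_approx measurableT mf ab); exact.
transitivity (limn (fun n => \int[m]_x (f_ n x)%:E)).
  rewrite -monotone_convergence//=.
  - apply: eq_integral => x _; apply/esym/cvg_lim => //.
    exact: cvg_nnsfun_approx.
  - by move=> n; exact/measurable_EFinP.
  - by move=> n x _; rewrite lee_fin.
  - by move=> x _ a b ab; rewrite lee_fin//; exact/lefP/nd_nnsfun_approx.
rewrite [RHS](_ : _ = limn (fun n => \int[mu]_x ((f_ n x)%:E * w x))); last first.
  rewrite -monotone_convergence//=.
  apply: eq_integral => x _; apply/esym/cvg_lim => //.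
  (* If w x = +oo, the products are 0 when f x = 0 and eventually +oo
     otherwise. *)
  rewrite [f x * w x]muleC; under eq_fun do rewrite muleC.
  have [wfin|] := boolP (w x \is a fin_num).
    by apply: cvgeZl => //; exact: cvg_nnsfun_approx.
  rewrite fin_numE negb_and !negbK => /orP[|] /eqP wx.
    by have := w0 x; rewrite wx.
  have fnf : (f_ n x)%:E @[n --> \oo] --> f x by exact: cvg_nnsfun_approx.
  have [fx0|fx0] := eqVneq (f x) 0.
    rewrite fx0 mule0; apply: cvg_near_cst; apply: nearW => n.
    have : (f_ n x)%:E <= f x by rewrite nnsfun_approxE; exact: le_approx.
    rewrite fx0 lee_fin => fn0; have -> : f_ n x = 0%R.
      by apply/eqP; rewrite eq_le fn0/=.
    by rewrite mule0.
  have fxp : 0 < f x by rewrite lt_neqAle eq_sym fx0 f0.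
  rewrite wx gt0_mulye//; apply: cvg_near_cst.
  have /fnf fn_gt0 : nbhs (f x) [set y | 0 < y] by exact: open_ereal_gt'.
  by apply: (@filterS _ \oo _ _ _ _ fn_gt0) => n /= fn0; rewrite gt0_mulye.
congr (limn _); apply/funext => n.
under [LHS]eq_integral do rewrite fimfunE -fsumEFin//.
rewrite [LHS]ge0_integral_fsum//; last 2 first.
  - by move=> r; exact/measurable_EFinP/measurableT_comp.
  - by move=> k x _; rewrite EFinM nnfun_muleindic_ge0.
under [RHS]eq_integral.
  move=> x _; rewrite fimfunE -fsumEFin// ge0_mule_fsuml; last first.
    by move=> r; rewrite EFinM nnfun_muleindic_ge0.
  over.
rewrite [RHS]ge0_integral_fsum//; last 2 first.
  - move=> r; apply: emeasurable_funM => //; apply/measurable_EFinP.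
    by do 2 apply/measurableT_comp => //.
  - by move=> r x _; rewrite mule_ge0// EFinM nnfun_muleindic_ge0.
apply: eq_fsbigr => r _.
have mr : measurable (f_ n @^-1` [set r]) by exact: measurable_sfunP.
rewrite integralZl_indic_nnsfun//= integral_indic// setIT mE//.
rewrite integral_mkcond -[in LHS]/(r%:E * _).
(* A value r that is not taken may be negative, but its level set is empty. *)
have [fr|nfr] := pselect (exists x, f_ n x = r).
  have r0 : (0 <= r)%R by case: fr => x <-.
  rewrite -ge0_integralZl//; last 2 first.
  - by apply/(measurable_restrictT _ mr).1; exact: measurable_funTS.
  - by move=> x _; apply: erestrict_ge0.
  apply: eq_integral => x _; rewrite EFinM -muleA; congr (_ * _).
  by rewrite epatch_indic muleC.
rewrite (_ : _ @^-1` _ = set0); last first.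
  by apply/seteqP; split => // x /= fx; case: nfr; exists x.
rewrite [X in _ * X](_ : _ = 0) ?mule0; last first.
  by apply: integral0_eq => x _; rewrite patchE in_set0.
rewrite integral0_eq// => x _; rewrite indicE in_set0.
by rewrite mulr0 mul0e.
Qed.

End density.

(** * Norms of classes and of operators *)

Section L1_facts.
Context d (T : measurableType d) (R : realType).
Variable mu : {measure set T -> \bar R}.
Local Notation L1 := (LspaceType1 mu).

Lemma L1_rep_measurable (u : L1) : measurable_fun setT (L1_rep u).
Proof. exact: (@measurable_funPT _ _ _ _ (L1_fun u)). Qed.

Lemma EFin_L1_norm (u : L1) : (`|u|%:E = \int[mu]_x `|L1_rep u x|%:E)%E.
Proof. exact: etrans (finite_norm_fine (L1_fun u)) (Lnorm1 _ _). Qed.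

Lemma L1_classK (u : L1) : L1_class (L1_fun u) = u.
Proof. by apply: L1_ext; exact: L1_classE. Qed.

Lemma L1_distE (u v : L1) :
  (`|u - v|%:E = \int[mu]_x `|L1_rep u x - L1_rep v x|%:E)%E.
Proof.
rewrite EFin_L1_norm; apply: ae_eq_integral => //.
- apply/measurable_EFinP; apply: measurableT_comp => //.
  exact: L1_rep_measurable.
- apply/measurable_EFinP; apply: measurableT_comp => //.
  by apply: measurable_funB; exact: L1_rep_measurable.
move: (L1_addE u (- v)) (L1_oppE v); apply: filterS2 => x h1 h2 xT.
by rewrite [u - v]/(L1_add u (L1_opp v)) h1// h2.
Qed.

Lemma Lfun1P (f : T -> R) : measurable_fun setT f ->
  (\int[mu]_x `|f x|%:E < +oo)%E -> f \in Lfun mu 1.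
Proof.
move=> mf ff; rewrite inE; apply/andP; split; rewrite inE//=.
by rewrite /finite_norm Lnorm1.
Qed.

Lemma EFin_norm_class (f : LfunType mu (@lexx _ _ 1%E)) :
  (`|L1_class f|%:E = \int[mu]_x `|f x|%:E)%E.
Proof.
rewrite EFin_L1_norm; apply: ae_eq_integral => //.
- apply/measurable_EFinP; apply: measurableT_comp => //.
  exact: L1_rep_measurable.
- apply/measurable_EFinP; apply: measurableT_comp => //.
by have := L1_classE f; apply: filterS => x fx xT; rewrite fx.
Qed.

End L1_facts.

Section bounded_operators.
Context (R : realType) (V : normedModType R).

Lemma opnorm_lty (A : V -> V) : linear A -> continuous A -> (opnorm A < +oo)%E.
Proof.
move=> linA contA.
have A0 : A 0 = 0.
  have := linA 1 0 0; rewrite !scale1r addr0 => /eqP.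
  by rewrite -subr_eq0 opprD addrA subrr sub0r oppr_eq0 => /eqP.
have AZ a u : A (a *: u) = a *: A u by have := linA a u 0; rewrite A0 !addr0.
have : \forall v \near (0 : V), `|A v| < 1.
  have /cvgrPdist_lt/(_ 1 ltr01) := contA 0; rewrite A0.
  by apply: filterS => v; rewrite sub0r normrN.
move=> /nbhs_normP[d /= d0 dA].
apply: (@le_lt_trans _ _ (2 / d)%:E); last exact: ltry.
apply: ge_ereal_sup => _ [u /= u1 <-]; rewrite lee_fin.
have : `|A ((d / 2) *: u)| < 1.
  apply: dA; rewrite /= sub0r normrN normrZ gtr0_norm ?divr_gt0//.
  rewrite (@le_lt_trans _ _ (d / 2))//; last by lra.
  by rewrite ler_piMr// divr_ge0// ltW.
rewrite AZ normrZ gtr0_norm ?divr_gt0// => /ltW.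
rewrite -ler_pdivlMl ?divr_gt0// mulr1 invf_div; exact.
Qed.

Lemma continuous_of_bound (A : V -> V) (M : R) : linear A ->
  (forall u, `|A u| <= M * `|u|) -> continuous A.
Proof.
move=> linA AM u; apply/cvgrPdist_lt => e e0.
have M0 : 0 < `|M| + 1 by rewrite ltr_wpDl.
near=> v; have -> : A u - A v = A (u - v).
  by rewrite [u - v]addrC -(scaleN1r v) linA scaleN1r addrC.
apply: le_lt_trans (AM _) _.
apply: (@le_lt_trans _ _ ((`|M| + 1) * `|u - v|)).
  by rewrite ler_wpM2r// (le_trans (ler_norm M))// lerDl.
rewrite -ltr_pdivlMl// mulrC; near: v.
by apply: cvgr_dist_lt; [exact: cvg_id|rewrite divr_gt0].
Unshelve. all: by end_near. Qed.

End bounded_operators.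

(** * The weighted space X_{0,alpha} *)

Section half_line.
Context (R : realType).
Local Notation leb := (@lebesgue_measure R).
Local Notation Rpos := (`]0, +oo[%classic : set R).

Lemma itv0yP (x : R) : Rpos x <-> 0 < x.
Proof. by rewrite /= in_itv/= andbT. Qed.

Lemma patch_itv0y (f : R -> R) (x : R) : 0 < x -> (f \_ Rpos) x = f x.
Proof. by move=> x0; rewrite patchE mem_set//; exact/itv0yP. Qed.

Lemma integral_itv_cst (a b C : R) : a < b ->
  (\int[leb]_(x in `[a, b]) C%:E = (C * (b - a))%:E)%E.
Proof.
move=> ab; transitivity (C%:E * leb `[a, b])%E; first by rewrite -integral_cst.
by rewrite /= lebesgue_measure_itv/= lte_fin ab.
Qed.

Lemma continuous_segment_bounded (f : R -> R) (a b : R) : a <= b ->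
  {within `[a, b], continuous f} ->
  exists M, forall x, a <= x <= b -> f x <= M.
Proof.
move=> ab cf; have [c _ fc] := EVT_max ab cf.
by exists (f c) => x axb; apply: fc; rewrite in_itv.
Qed.

Lemma patch_continuous (h : R -> R) (a b y : R) : continuous h ->
  y != a -> y != b -> {for y, continuous (h \_ `[a, b])}.
Proof.
move=> ch ya yb.
have out z : z < a \/ b < z -> (h \_ `[a, b]) z = 0.
  move=> H; rewrite patchE memNset//= in_itv/=.
  by case: H => H; rewrite leNgt ?H//= andbC leNgt H.
have zero (P : set R) : nbhs y P -> (forall z, P z -> (h \_ `[a, b]) z = 0) ->
    {for y, continuous (h \_ `[a, b])}.
  move=> yP P0; have P0y := P0 _ (nbhs_singleton yP).
  rewrite /prop_for /continuous_at P0y; apply: cvg_near_cst.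
  by apply: filterS yP => z /P0.
have [ay|ay|e] := ltgtP y a; last by rewrite e eqxx in ya.
  by apply: (zero _ (lt_nbhsl ay)) => z za; apply: out; left.
have [yb'|yb'|e] := ltgtP y b; last by rewrite e eqxx in yb.
  have inE' z : a <= z -> z <= b -> (h \_ `[a, b]) z = h z.
    by move=> az zb; rewrite patchE mem_set//= in_itv/= az.
  rewrite /prop_for /continuous_at inE' ?ltW//.
  apply: cvg_trans (ch y); apply: near_eq_cvg; near=> z.
  rewrite inE'//; apply/ltW; near: z; [exact: lt_nbhsr|exact: lt_nbhsl].
by apply: (zero _ (lt_nbhsr yb')) => z za; apply: out; right.
Unshelve. all: by end_near. Qed.

End half_line.

Section weighted_space.
Context (R : realType) (alpha : R).
Local Notation leb := (@lebesgue_measure R).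
Local Notation mu := (weighted_measure alpha).
Local Notation Rpos := (`]0, +oo[%classic : set R).

Lemma weight_measurable : measurable_fun [set: R] (fun x : R => (1 + x) `^ alpha).
Proof.
apply: (measurableT_comp (measurable_powR alpha)).
exact: measurable_funD.
Qed.

Lemma integral_weighted_measure (f : R -> \bar R) :
  measurable_fun setT f -> (forall x, 0 <= f x)%E ->
  (\int[mu]_x f x =
   \int[leb]_(x in `]0%R, +oo[) (f x * ((1 + x) `^ alpha)%:E))%E.
Proof.
move=> mf f0; set w := (fun x : R => ((1 + x) `^ alpha)%:E).
have mw : measurable_fun setT w.
  by apply/measurable_EFinP; exact: weight_measurable.
rewrite (@ge0_integral_density _ _ _ leb (w \_ `]0%R, +oo[%classic))//.
- rewrite [RHS]integral_mkcond; apply: eq_integral => x _.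
  by rewrite !patchE; case: ifP => _; rewrite ?mule0.
- apply/(measurable_restrictT w) => //; exact: measurable_funTS.
- by move=> x; apply: erestrict_ge0 => y _; rewrite lee_fin powR_ge0.
- by move=> A mA; rewrite -integral_mkcondr.
Qed.

Lemma ae_weighted_measure (P : R -> Prop) :
  (forall x, 0 < x -> P x) -> {ae mu, forall x, P x}.
Proof.
move=> P0; exists `]-oo, 0]%classic; split => //.
  rewrite [LHS]/weighted_measure (_ : _ `&` _ = set0) ?integral_set0//.
  apply/seteqP; split => // x [/=]; rewrite !in_itv/= andbT => x0.
  by rewrite ltNge x0.
by move=> x /= Px; rewrite in_itv/= leNgt; apply/negP => /P0.
Qed.

Lemma weighted_measure_set1 (a : R) : mu [set a] = 0%E.
Proof.
rewrite /= /weighted_measure.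
by apply: (@integral_Sset1 _ _ _ a); exact: subIsetl.
Qed.

Hypothesis alpha_gt0 : 0 < alpha.

Lemma le_weight (x y : R) : 0 < x -> x <= y ->
  (1 + x) `^ alpha <= (1 + y) `^ alpha.
Proof.
move=> x0 xy; apply: ge0_ler_powR;
  rewrite ?nnegrE ?(ltW alpha_gt0) ?lerD2l//; lra.
Qed.

Lemma weight_gt0 (x : R) : 0 < x -> 0 < (1 + x) `^ alpha.
Proof. by move=> x0; rewrite powR_gt0// ltr_wpDl. Qed.

Lemma weight_continuous (x : R) : 0 < x ->
  {for x, continuous (fun x : R => (1 + x) `^ alpha)}.
Proof.
move=> x0.
apply: (@continuous_comp _ _ _ (fun x : R => 1 + x) (fun y : R => y `^ alpha)).
  by apply: continuousD; [exact: cst_continuous|exact: cvg_id].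
apply/differentiable_continuous/derivable1_diffP.
by apply: derivable_powR; rewrite in_itv/= andbT ltr_wpDl.
Qed.

(** The weight is largest at the right end of [a, b]. *)
Lemma integral_weighted_itv_le (k : R -> R) (a b : R) : 0 < a -> a < b ->
  measurable_fun setT k -> (forall x, 0 <= k x) ->
  (\int[mu]_x ((k \_ `[a, b]) x)%:E <=
   ((1 + b) `^ alpha)%:E * \int[leb]_(x in `[a, b]) (k x)%:E)%E.
Proof.
move=> a0 ab mk k0; have mI : measurable (`[a, b]%classic : set R) by [].
have mkI : measurable_fun setT (k \_ `[a, b]).
  by apply/(measurable_restrictT k) => //; exact: measurable_funTS.
rewrite integral_weighted_measure; last 2 first.
- exact/measurable_EFinP.
- by move=> x; rewrite lee_fin patchE; case: ifP.
rewrite -ge0_integralZl//; last 3 first.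
- by apply/measurable_EFinP; exact: measurable_funTS.
- by move=> x _; rewrite lee_fin.
- by rewrite lee_fin powR_ge0.
rewrite [leLHS]integral_mkcond [leRHS]integral_mkcond.
apply: ge0_le_integral => //.
- move=> x _; apply: erestrict_ge0 => y _.
  rewrite -EFinM lee_fin mulr_ge0 ?powR_ge0//.
  by rewrite patchE; case: ifP.
- apply/(measurable_restrictT
    (fun x => (((k \_ `[a, b]) x)%:E * ((1 + x) `^ alpha)%:E)%E)) => //.
  apply/measurable_EFinP; apply: measurable_funTS; apply: measurable_funM => //.
  exact: weight_measurable.
- apply/(measurable_restrictT
    (fun x => (((1 + b) `^ alpha)%:E * (k x)%:E)%E)) => //.
  by apply/measurable_EFinP; apply: measurable_funTS; exact: measurable_funM.
move=> x _; rewrite !patchE; case: ifPn => xD; last first.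
  by case: ifP => // _; rewrite -EFinM lee_fin mulr_ge0 ?powR_ge0.
case: ifPn => [/set_mem/=|_]; last by rewrite mul0e.
rewrite in_itv/= => /andP[ax xb]; rewrite -!EFinM lee_fin mulrC.
by rewrite ler_wpM2r// le_weight//; exact: lt_le_trans ax.
Qed.

Lemma patch_itv_Lfun (h : R -> R) (a b : R) : 0 < a -> a < b ->
  continuous h -> h \_ `[a, b] \in Lfun mu 1.
Proof.
move=> a0 ab ch; have mI : measurable (`[a, b]%classic : set R) by [].
have mh : measurable_fun setT h by exact: continuous_measurable_fun.
apply: Lfun1P.
  by apply/(measurable_restrictT h) => //; exact: measurable_funTS.
have mnh : measurable_fun setT (fun x => `|h x|) by exact: measurableT_comp.
apply: le_lt_trans (_ : \int[mu]_x (((fun x => `|h x|) \_ `[a, b]) x)%:E < _)%E.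
  rewrite le_eqVlt; apply/orP; left; apply/eqP; apply: eq_integral => x _.
  by rewrite !patchE; case: ifP; rewrite ?normr0.
apply: le_lt_trans (integral_weighted_itv_le a0 ab mnh _) _ => //.
rewrite lte_mul_pinfty ?lee_fin ?powR_ge0//.
have /integrableP[_] : leb.-integrable `[a, b] (EFin \o h).
  apply: continuous_compact_integrable; first exact: segment_compact.
  exact: continuous_subspaceT.
by [].
Qed.

(** Dominated convergence for the truncations of f to the intervals
    [1 / (n + 1), n + 2], which exhaust (0, +oo). *)
Lemma weighted_truncation (f : R -> R) (e : R) : measurable_fun setT f ->
  (\int[mu]_x `|f x|%:E < +oo)%E -> 0 < e ->
  exists a b : R, [/\ 0 < a, a < b &
    (\int[mu]_x `|f x - (f \_ `[a, b]) x|%:E < e%:E)%E].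
Proof.
move=> mf ff e0.
pose I (n : nat) : set R := `[n.+1%:R^-1, n.+2%:R]%classic.
have mI n : measurable (I n) by exact: measurable_itv.
have mfI n : measurable_fun setT (f \_ (I n)).
  by apply/(measurable_restrictT f) => //; exact: measurable_funTS.
have [|||||_ f_cvg _] := @dominated_convergence _ _ _ mu setT measurableT
  (fun n => EFin \o (f \_ (I n))) (EFin \o f) (fun x => `|f x|%:E).
- by move=> n; apply/measurable_EFinP; exact: mfI.
- exact/measurable_EFinP.
- apply: ae_weighted_measure => x x0 _; apply: cvg_near_cst; near=> n.
  rewrite /= patchE mem_set// /I/= in_itv/=; apply/andP; split.
    apply/ltW; near: n; exact: near_infty_natSinv_lt (PosNum x0).
  near: n; exists (Num.truncn x).+1 => // n /= xn.
  apply/ltW/(lt_le_trans (Num.Theory.truncnS_gt x)); rewrite ler_nat.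
  by rewrite (leq_trans xn)// leqW.
- apply/integrableP; split.
    by apply/measurable_EFinP; exact: measurableT_comp.
  by under eq_integral do rewrite abse_EFin normr_id.
- apply: aeW => x n _; rewrite /= lee_fin patchE.
  by case: ifP => _; rewrite ?normr0.
have /f_cvg[n _ /(_ n (leqnn n)) fn] : nbhs (0%E : \bar R) [set z | (z < e%:E)%E].
  by apply: open_ereal_lt'; rewrite lte_fin.
exists n.+1%:R^-1, n.+2%:R; split.
- by rewrite invr_gt0 ltr0n.
- apply: (@le_lt_trans _ _ 1); first by rewrite invf_le1 ?ltr0n// ler1n.
  by rewrite ltr1n.
apply: le_lt_trans fn.
rewrite le_eqVlt; apply/orP; left; apply/eqP; apply: eq_integral => x _.
by rewrite distrC.
Unshelve. all: by end_near. Qed.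

(** Once f is truncated to [a, b], where the weight lies between 1 and
    (1 + b)^alpha, the density of continuous functions for the Lebesgue
    measure carries over to the weighted measure. *)
Lemma weighted_approximation (f : R -> R) (e : R) : measurable_fun setT f ->
  (\int[mu]_x `|f x|%:E < +oo)%E -> 0 < e ->
  exists (a b : R) (h : R -> R), [/\ 0 < a, a < b, continuous h &
    (\int[mu]_x `|f x - (h \_ `[a, b]) x|%:E < e%:E)%E].
Proof.
move=> mf ff e0.
have e20 : 0 < e / 2 by rewrite divr_gt0.
have [a [b [a0 ab fE]]] := weighted_truncation mf ff e20.
pose E : set R := `[a, b]%classic.
have mE : measurable E by exact: measurable_itv.
have mnf : measurable_fun setT (fun x => `|f x|) by exact: measurableT_comp.
have intf : leb.-integrable E (EFin \o f).
  apply/integrableP; split.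
    by apply/measurable_EFinP; exact: measurable_funTS.
  apply: le_lt_trans ff; rewrite integral_weighted_measure; last 2 first.
  - exact/measurable_EFinP.
  - by move=> x; rewrite lee_fin.
  have ED : E `<=` Rpos.
    move=> x; rewrite /E/= !in_itv/= andbT => /andP[ax _].
    exact: lt_le_trans ax.
  have mfw : measurable_fun Rpos (fun x => (`|f x|%:E * ((1 + x) `^ alpha)%:E)%E).
    apply/measurable_EFinP; apply: measurable_funTS; apply: measurable_funM => //.
    exact: weight_measurable.
  apply: (@le_trans _ _
    (\int[leb]_(x in E) (`|f x|%:E * ((1 + x) `^ alpha)%:E))%E).
    apply: ge0_le_integral => //.
    - apply/measurable_EFinP; exact: measurable_funTS.
    - exact: measurable_funS mfw.
    move=> x /ED/itv0yP x0; rewrite /= -EFinM lee_fin ler_peMr//.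
    apply: (@le_trans _ _ (1 `^ alpha)); first by rewrite powR1.
    apply: ge0_ler_powR.
    + exact: ltW.
    + by rewrite nnegrE.
    + by rewrite nnegrE addr_ge0// ltW.
    + by rewrite lerDl ltW.
  apply: ge0_subset_integral => //.
  by move=> x _; rewrite -EFinM lee_fin mulr_ge0 ?powR_ge0.
have Elty : (leb E < +oo)%E by rewrite /= lebesgue_measure_itv/= lte_fin ab ltry.
have [g [cg _ g_cvg]] := approximation_continuous_integrable mE Elty intf.
have w0 : 0 < (1 + b) `^ alpha by exact/weight_gt0/(lt_trans a0).
have /g_cvg[n _ /(_ n (leqnn n)) gn] :
    nbhs (0%E : \bar R) [set z | (z < (e / 2 / (1 + b) `^ alpha)%:E)%E].
  by apply: open_ereal_lt'; rewrite lte_fin divr_gt0.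
exists a, b, (g n); split => //.
have mg : measurable_fun setT (g n) by exact: continuous_measurable_fun.
pose k x := `|f x - g n x|.
have mk : measurable_fun setT k.
  by apply: measurableT_comp => //; exact: measurable_funB.
have k0 x : 0 <= k x by rewrite /k.
have mkE : measurable_fun setT (k \_ E).
  by apply/(measurable_restrictT k) => //; exact: measurable_funTS.
have mfE : measurable_fun setT (f \_ E).
  by apply/(measurable_restrictT f) => //; exact: measurable_funTS.
have mgE : measurable_fun setT (g n \_ E).
  by apply/(measurable_restrictT (g n)) => //; exact: measurable_funTS.
have m1 : measurable_fun setT (fun x => `|f x - (f \_ E) x|).
  by apply: measurableT_comp => //; exact: measurable_funB.
apply: (@le_lt_trans _ _
  (\int[mu]_x (`|f x - (f \_ E) x|%:E + ((k \_ E) x)%:E))%E).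
  apply: ge0_le_integral => //.
  - apply/measurable_EFinP; apply: measurableT_comp => //; exact: measurable_funB.
  - by apply: emeasurable_funD; exact/measurable_EFinP.
  move=> x _; rewrite -EFinD lee_fin !patchE; case: ifP => _.
    by rewrite subrr normr0 add0r.
  by rewrite addr0.
rewrite ge0_integralD//; last 3 first.
- exact/measurable_EFinP.
- by move=> x _; rewrite lee_fin patchE; case: ifP.
- exact/measurable_EFinP.
rewrite [e]splitr EFinD lteD//.
apply: le_lt_trans (integral_weighted_itv_le a0 ab mk k0) _.
by rewrite muleC -lte_pdivlMr.
Qed.

End weighted_space.

Section transport.
Context (R : realType) (r : R -> R).
Hypothesis r_cont : {in `]0, +oo[, continuous r}.
Hypothesis r_gt0 : forall x : R, 0 < x -> 0 < r x.
Local Notation leb := (@lebesgue_measure R).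
Local Notation Rpos := (`]0, +oo[%classic : set R).
Local Notation flow_back := (flow_back r).
Local Notation flow_fwd := (flow_fwd r).

(** * The clock, a primitive of 1 / r, and its inverse *)

(** The base point is 1 because 1 / r is not integrable near 0. *)
Definition clock (x : R) : R :=
  if 1 <= x then \int[leb]_(tau in `[1, x]) (r tau)^-1
  else - \int[leb]_(tau in `[x, 1]) (r tau)^-1.

Lemma r_continuous_at (x : R) : 0 < x -> {for x, continuous r}.
Proof. by move=> x0; apply: r_cont; rewrite in_itv/= x0. Qed.

Lemma rV_continuous_at (x : R) :
  0 < x -> {for x, continuous (fun x => (r x)^-1)}.
Proof.
move=> x0; apply: (@cvgV _ _ _ _ r); last exact: r_continuous_at.
by rewrite gt_eqF ?r_gt0.
Qed.

Lemma rV_integrable (a b : R) :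
  0 < a -> leb.-integrable `[a, b] (EFin \o (fun x => (r x)^-1)).
Proof.
move=> a0; apply: continuous_compact_integrable; first exact: segment_compact.
apply: continuous_in_subspaceT => x /set_mem/=; rewrite in_itv/= => /andP[ax _].
by apply: rV_continuous_at; exact: lt_le_trans ax.
Qed.

(** With a base point below both x and 1 there is no sign to distinguish, so
    that additivity and the fundamental theorem of calculus apply. *)
Lemma clockE (a x : R) : 0 < a -> a <= x -> a <= 1 ->
  clock x = \int[leb]_(tau in `[a, x]) (r tau)^-1
            - \int[leb]_(tau in `[a, 1]) (r tau)^-1.
Proof.
move=> a0 ax a1; rewrite /clock; case: (leP 1 x) => [x1|/ltW x1].
  rewrite Rintegral_itvB ?bnd_simp//; last exact: rV_integrable.
  rewrite Rintegral_itv_obnd_cbnd//.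
  apply: integrableS (rV_integrable x a0) => //.
  by apply: subset_itvr; rewrite bnd_simp.
apply/esym; rewrite -opprB; congr (- _).
rewrite Rintegral_itvB ?bnd_simp//; last exact: rV_integrable.
rewrite Rintegral_itv_obnd_cbnd//.
apply: integrableS (rV_integrable 1 a0) => //.
by apply: subset_itvr; rewrite bnd_simp.
Qed.

Lemma travel_timeE (x y : R) : 0 < x -> x <= y ->
  travel_time r x y = (clock y - clock x)%:E.
Proof.
move=> x0 xy; set a := Num.min x 1.
have a0 : 0 < a by rewrite lt_min x0 ltr01.
have ax : a <= x by rewrite ge_min lexx.
have a1 : a <= 1 by rewrite ge_min lexx orbT.
rewrite (clockE a0 ax a1) (clockE a0 (le_trans ax xy) a1) opprB addrA subrK.
rewrite Rintegral_itvB ?bnd_simp//; last exact: rV_integrable.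
rewrite Rintegral_itv_obnd_cbnd/Rintegral; last first.
  apply: integrableS (rV_integrable y a0) => //.
  by apply: subset_itvr; rewrite bnd_simp.
rewrite fineK//.
by apply: integrable_fin_num; [exact: measurable_itv|exact: rV_integrable].
Qed.

Lemma is_derive_clock (x : R) : 0 < x -> is_derive x 1 clock (r x)^-1.
Proof.
move=> x0; set a := Num.min x 1 / 2.
have a0 : 0 < a by rewrite divr_gt0// lt_min x0 ltr01.
have ax : a < x.
  have : Num.min x 1 <= x by rewrite ge_min lexx.
  by rewrite /a; lra.
have a1 : a <= 1.
  have : Num.min x 1 <= 1 by rewrite ge_min lexx orbT.
  by rewrite /a; lra.
have [] := @continuous_FTC1_closed R (fun x => (r x)^-1) a x (x + 1).
- by rewrite ltrDl.
- exact: rV_integrable.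
- exact: ax.
- exact: rV_continuous_at.
set F := fun x => _ => dF F'x.
have dFx : is_derive x 1 (fun z => F z - F 1) (r x)^-1.
  rewrite -F'x derive1E -[X in is_derive _ _ _ X]subr0.
  by apply: is_deriveB; apply/derivableP.
apply: near_eq_is_derive dFx.
near=> z; rewrite (@clockE a z)//.
by apply/ltW; near: z; exact: lt_nbhsr.
Unshelve. all: by end_near. Qed.

Lemma rV_measurable : measurable_fun Rpos (fun x => (r x)^-1).
Proof.
apply: open_continuous_measurable_fun; first exact: interval_open.
by move=> x /set_mem/=; rewrite in_itv/= andbT; exact: rV_continuous_at.
Qed.

Lemma clock_continuous (x : R) : 0 < x -> {for x, continuous clock}.
Proof.
move=> x0; have [dx _] := is_derive_clock x0.
exact/differentiable_continuous/derivable1_diffP.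
Qed.

Lemma clock_continuous_within (a b : R) : 0 < a ->
  {within `[a, b], continuous clock}.
Proof.
move=> a0; apply: continuous_in_subspaceT => x /set_mem/=.
rewrite in_itv/= => /andP[ax _].
by apply: clock_continuous; exact: lt_le_trans ax.
Qed.

Lemma clock_lt (x y : R) : 0 < x -> x < y -> clock x < clock y.
Proof.
move=> x0 xy.
have dclock z : z \in `]x, y[ -> is_derive z 1 clock (r z)^-1.
  rewrite in_itv/= => /andP[xz _].
  by apply: is_derive_clock => //; exact: lt_trans xz.
have [c cxy dc] := MVT xy dclock (clock_continuous_within (b := y) x0).
rewrite -subr_gt0 dc mulr_gt0 ?subr_gt0// invr_gt0 r_gt0//.
by move: cxy; rewrite in_itv/= => /andP[xc _]; exact: lt_trans xc.
Qed.

Lemma clock_ler (x y : R) : 0 < x -> 0 < y -> (clock x <= clock y) = (x <= y).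
Proof.
move=> x0 y0; apply/idP/idP => [|].
  by apply: contra_le => yx; exact: clock_lt.
by rewrite le_eqVlt => /predU1P[->//|xy]; apply/ltW/clock_lt.
Qed.

Lemma clock_inj (x y : R) : 0 < x -> 0 < y -> clock x = clock y -> x = y.
Proof.
move=> x0 y0 xy; apply/eqP.
by rewrite eq_le -(clock_ler x0 y0) -(clock_ler y0 x0) xy lexx.
Qed.

(** By monotone convergence, a bound on the integrals over the sets F n would
    bound the integral over their union. *)
Lemma travel_time_unbounded (F : (set R)^nat) (E : set R) (M : R) :
  nondecreasing_seq F -> (forall n, measurable (F n)) -> E = \bigcup_n F n ->
  E `<=` `]0, +oo[ ->
  (\int[leb]_(tau in E) ((r tau)^-1)%:E = +oo)%E ->
  exists n, (M%:E < \int[leb]_(tau in F n) ((r tau)^-1)%:E)%E.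
Proof.
move=> ndF mF FE E0 EI; apply: contrapT => FM.
have Fgt0 n x : F n x -> 0 < x.
  move=> Fnx; have Ex : E x by rewrite FE; exists n.
  exact/itv0yP/E0.
have Foo : (\int[leb]_(tau in F n) ((r tau)^-1)%:E @[n --> \oo] --> +oo)%E.
  rewrite -EI FE; apply: ge0_nondecreasing_set_cvg_integral => //.
  - move=> n; apply/measurable_EFinP; apply: measurable_funS rV_measurable => //.
    by move=> x /Fgt0/=; rewrite in_itv/= andbT.
  - by move=> n x /Fgt0 x0; rewrite lee_fin invr_ge0 ltW// r_gt0.
suff : (+oo <= M%:E :> \bar R)%E by rewrite leye_eq.
apply: cvge_le Foo.
by apply: nearW => n; rewrite leNgt; apply/negP => ?; apply: FM; exists n.
Qed.

Hypothesis r_int0 :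
  (\int[leb]_(tau in `]0%R, 1%R[) ((r tau)^-1)%:E = +oo)%E.
Hypothesis r_intoo :
  (\int[leb]_(tau in `]1%R, +oo[) ((r tau)^-1)%:E = +oo)%E.

Lemma clock_unbounded_above (M : R) : exists2 x, 0 < x & M <= clock x.
Proof.
have [||||n] := @travel_time_unbounded
  (fun n => `]1, 1 + n%:R]%classic) `]1, +oo[%classic (M - clock 1)
  _ _ _ _ r_intoo.
- move=> m n mn; rewrite subsetEset; apply: subset_itvl.
  by rewrite bnd_simp lerD2l ler_nat.
- by [].
- exact: itv_bndy_bigcup_BRight.
- by apply: subset_itvr; rewrite bnd_simp.
rewrite integral_itv_obnd_cbnd; last first.
  apply/measurable_EFinP; apply: measurable_funS rV_measurable => //.
  move=> x/=; rewrite !in_itv/= andbT => /andP[+ _]; exact: lt_trans.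
rewrite -/(travel_time r 1 (1 + n%:R)) travel_timeE// ?lerDl// lte_fin => /ltW.
by rewrite lerBrDr subrK => Mn; exists (1 + n%:R) => //; rewrite ltr_wpDr.
Qed.

Lemma clock_unbounded_below (M : R) : exists2 x, 0 < x & clock x <= M.
Proof.
have [||||n] := @travel_time_unbounded
  (fun n => `[0 + n.+1%:R^-1, 1[%classic) `]0, 1[%classic (clock 1 - M)
  _ _ _ _ r_int0.
- move=> m n mn; rewrite subsetEset; apply: subset_itvr.
  by rewrite bnd_simp lerD2l lef_pV2 ?posrE ?ltr0n// ler_nat.
- by [].
- exact: itv_open_bnd_bigcup.
- by apply: subset_itvl; rewrite bnd_simp.
have n0 : 0 < n.+1%:R^-1 :> R by rewrite invr_gt0 ltr0n.
rewrite add0r integral_itv_bndo_bndc; last first.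
  apply/measurable_EFinP; apply: measurable_funS rV_measurable => //.
  move=> x/=; rewrite !in_itv/= andbT => /andP[+ _]; exact: lt_le_trans.
have n1 : n.+1%:R^-1 <= 1 :> R by rewrite invf_le1 ?ltr0n// ler1n.
rewrite -/(travel_time r n.+1%:R^-1 1) travel_timeE// lte_fin => /ltW.
by rewrite lerD2l lerN2 => Mn; exists n.+1%:R^-1.
Qed.

(** The inverse of [clock], which maps (0, +oo) onto R. *)
Definition position (s : R) : R := xget 1 [set x | 0 < x /\ clock x = s].

Let positionP (s : R) : 0 < position s /\ clock (position s) = s.
Proof.
suff [x sx] : exists x, 0 < x /\ clock x = s.
  by rewrite /position; case: xgetP => [y _ //|/(_ x)/(_ sx)].
have [a a0 sa] := clock_unbounded_below s.
have [b b0 sb] := clock_unbounded_above s.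
have ab : a <= b by rewrite -clock_ler// (le_trans sa).
have [|c] := IVT ab (clock_continuous_within (b := b) a0) (v := s).
  by rewrite ge_min sa/= le_max sb orbT.
rewrite in_itv/= => /andP[ac _] cs; exists c; split => //.
exact: lt_le_trans ac.
Qed.

Lemma position_gt0 (s : R) : 0 < position s. Proof. by case: (positionP s). Qed.

Lemma positionK (s : R) : clock (position s) = s.
Proof. by case: (positionP s). Qed.

Lemma clockK (x : R) : 0 < x -> position (clock x) = x.
Proof.
by move=> x0; apply: clock_inj (positionK _) => //; exact: position_gt0.
Qed.

Lemma position_ler : {mono position : s t / s <= t}.
Proof. by move=> s t; rewrite -clock_ler ?position_gt0// !positionK. Qed.

Lemma position_lt (s x : R) : 0 < x -> (position s < x) = (s < clock x).
Proof. by move=> x0; rewrite -{1}(clockK x0) !ltNge position_ler. Qed.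

Lemma position_ge (s x : R) : 0 < x -> (x <= position s) = (clock x <= s).
Proof. by move=> x0; rewrite -{1}(clockK x0) position_ler. Qed.

(** The differential equation x' = r(x) whose flow is studied. *)
Lemma is_derive_position (s : R) : is_derive s 1 position (r (position s)).
Proof.
have s0 := position_gt0 s.
rewrite -{1}(positionK s) -[X in is_derive _ _ _ X]invrK.
apply: is_derive_inverse.
- near=> z; apply: clockK; near: z; exact: lt_nbhsr.
- near=> z; apply: clock_continuous; near: z; exact: lt_nbhsr.
- exact: is_derive_clock.
- by rewrite invr_eq0 gt_eqF// r_gt0.
Unshelve. all: by end_near. Qed.

Lemma position_continuous : continuous position.
Proof.
move=> s; have [ds _] := is_derive_position s.
exact/differentiable_continuous/derivable1_diffP.
Qed.

(** * The flow *)

(** In the variable [clock], moving back for a time t is subtracting t. *)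
Lemma flow_backE (y t : R) : 0 <= t -> 0 < y ->
  flow_back y t = position (clock y - t).
Proof.
move=> t0 y0; set x := position _.
have xE : clock x = clock y - t by rewrite positionK.
have x0 : 0 < x := position_gt0 _.
have xy : x <= y by rewrite -clock_ler// xE gerBl.
rewrite /flow_back; case: xgetP => [z _ [/andP[z0 zy]]|/(_ x)[]].
  rewrite travel_timeE// => -[ez]; apply: clock_inj => //.
  by rewrite xE; lra.
by split; [exact/andP|]; rewrite travel_timeE// xE; congr EFin; lra.
Qed.

Lemma flow_fwdE (x t : R) : 0 <= t -> 0 < x ->
  flow_fwd x t = position (clock x + t).
Proof.
move=> t0 x0; set y := position _.
have yE : clock y = clock x + t by rewrite positionK.
have y0 : 0 < y := position_gt0 _.
have xy : x <= y by rewrite -clock_ler// yE lerDl.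
rewrite /flow_fwd; case: xgetP => [z _ [xz]|/(_ y)[]].
  have z0 : 0 < z := lt_le_trans x0 xz.
  rewrite travel_timeE// => -[ez]; apply: clock_inj => //.
  by rewrite yE; lra.
by split => //; rewrite travel_timeE// yE; congr EFin; lra.
Qed.

Lemma flow_back_gt0 (y t : R) : 0 <= t -> 0 < y -> 0 < flow_back y t.
Proof. by move=> t0 y0; rewrite flow_backE//; exact: position_gt0. Qed.

Lemma flow_back0 (y : R) : 0 < y -> flow_back y 0 = y.
Proof. by move=> y0; rewrite flow_backE// subr0 clockK. Qed.

Lemma flow_backD (s t y : R) : 0 <= s -> 0 <= t -> 0 < y ->
  flow_back y (s + t) = flow_back (flow_back y s) t.
Proof.
move=> s0 t0 y0; rewrite [RHS]flow_backE ?flow_back_gt0//.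
by rewrite !flow_backE ?addr_ge0// positionK// opprD addrA.
Qed.

Lemma flow_fwd_gt0 (x t : R) : 0 <= t -> 0 < x -> 0 < flow_fwd x t.
Proof. by move=> t0 x0; rewrite flow_fwdE//; exact: position_gt0. Qed.

Lemma flow_backK (y t : R) : 0 <= t -> 0 < y -> flow_fwd (flow_back y t) t = y.
Proof.
move=> t0 y0; rewrite flow_fwdE ?flow_back_gt0//.
by rewrite flow_backE// positionK// subrK clockK.
Qed.

Lemma flow_fwd_ge (x t : R) : 0 <= t -> 0 < x -> x <= flow_fwd x t.
Proof. by move=> t0 x0; rewrite flow_fwdE// position_ge// lerDl. Qed.

Lemma le_flow_fwd (x x' t t' : R) : 0 <= t -> t <= t' -> 0 < x -> x <= x' ->
  flow_fwd x t <= flow_fwd x' t'.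
Proof.
move=> t0 tt' x0 xx'.
rewrite !flow_fwdE ?(le_trans t0)//; last exact: lt_le_trans xx'.
by rewrite position_ler// lerD// clock_ler//; exact: lt_le_trans xx'.
Qed.

Lemma flow_back_ge (x y t : R) : 0 <= t -> 0 < x -> 0 < y ->
  (x <= flow_back y t) = (flow_fwd x t <= y).
Proof.
move=> t0 x0 y0; rewrite flow_backE// flow_fwdE// position_ge//.
by rewrite -{2}(clockK y0) position_ler// lerBrDr.
Qed.

Lemma flow_back_le (x y t : R) : 0 <= t -> 0 < x -> 0 < y ->
  (flow_back y t <= x) = (y <= flow_fwd x t).
Proof.
move=> t0 x0 y0; rewrite flow_backE// flow_fwdE// position_ge//.
by rewrite -{1}(clockK x0) position_ler// lerBlDr.
Qed.

Lemma is_derive_flow_back (t y : R) : 0 <= t -> 0 < y ->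
  is_derive y 1 (flow_back ^~ t) (r (flow_back y t) / r y).
Proof.
move=> t0 y0.
have dclock := is_derive_clock y0.
have dpos := is_derive_position (clock y - t).
have dsub : is_derive y 1 (clock - cst t) (r y)^-1.
  by rewrite -[(r y)^-1]subr0; exact: is_deriveB.
have dcomp := is_derive1_comp (f := position) (g := clock - cst t) dpos dsub.
rewrite flow_backE//.
apply: near_eq_is_derive dcomp.
near=> z; rewrite flow_backE//=; near: z; exact: lt_nbhsr.
Unshelve. all: by end_near. Qed.

Lemma flow_back_continuous (t y : R) : 0 <= t -> 0 < y ->
  {for y, continuous (flow_back ^~ t)}.
Proof.
move=> t0 y0; have [dy _] := is_derive_flow_back t0 y0.
exact/differentiable_continuous/derivable1_diffP.
Qed.

Lemma flow_fwd_continuous (t x : R) : 0 <= t -> 0 < x ->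
  {for x, continuous (flow_fwd ^~ t)}.
Proof.
move=> t0 x0; rewrite /prop_for /continuous_at /= flow_fwdE//.
have : position (clock z + t) @[z --> x] --> position (clock x + t).
  apply: continuous_cvg; first exact: position_continuous.
  by apply: cvgD; [exact: clock_continuous|exact: cvg_cst].
apply: cvg_trans; apply: near_eq_cvg; near=> z.
rewrite flow_fwdE//; near: z; exact: lt_nbhsr.
Unshelve. all: by end_near. Qed.

(** * Change of variables along the flow *)

Lemma clock_measurable : measurable_fun Rpos clock.
Proof.
apply: open_continuous_measurable_fun; first exact: interval_open.
by move=> x /set_mem/=; rewrite in_itv/= andbT; exact: clock_continuous.
Qed.

(** The image of dx / r(x) under [clock] + c is the Lebesgue measure: the
    preimage of ]a, b] goes from position (a - c) to position (b - c), and its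
    measure is the travel time between these points, b - a. Letting c vary
    builds the invariance of the Lebesgue measure under translations into the
    statement. *)
Lemma integral_clock (c : R) (G : R -> \bar R) :
  measurable_fun setT G -> (forall s, 0 <= G s)%E ->
  (\int[leb]_(x in `]0%R, +oo[) (G (clock x + c)%R * ((r x)^-1)%:E) =
   \int[leb]_s G s)%E.
Proof.
move=> mG G0; have mRpos : measurable Rpos by exact: measurable_itv.
pose phi : measurableTypeR R -> measurableTypeR R :=
  (fun x => clock x + c) \_ Rpos.
pose w : R -> \bar R := (fun x => ((r x)^-1)%:E) \_ Rpos.
have mphi : measurable_fun setT phi.
  apply/(measurable_restrictT (fun x => clock x + c)) => //.
  exact: (measurable_funD clock_measurable (measurable_cst c)).
have mw : measurable_fun [set: R] w.
  apply/(measurable_restrictT (fun x => ((r x)^-1)%:E)) => //.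
  apply/measurable_EFinP.
  exact: rV_measurable.
have w0 x : (0 <= w x)%E.
  apply: erestrict_ge0 => y /itv0yP y0.
  by rewrite lee_fin invr_ge0 ltW ?r_gt0.
pose m : {measure set (measurableTypeR R) -> \bar R} := density leb mw w0.
have mE (A : set (measurableTypeR R)) :
    measurable A -> leb A = pushforward m phi A.
  apply: lebesgue_measure_unique => _ [[a b] _ <-] /=.
  rewrite /pushforward /m /density.
  rewrite -integral_mkcondr
    (_ : _ `&` _ = `]position (a - c), position (b - c)]%classic); last first.
    apply/seteqP; split=> x.
      move=> [+ /itv0yP x0]; rewrite /phi /= patch_itv0y// !in_itv/=.
      by rewrite position_lt// position_ge// ltrBlDr lerBrDr.
    rewrite /= in_itv/= => /andP[ax xb].
    have x0 : 0 < x by apply: le_lt_trans ax; rewrite ltW// position_gt0.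
    split; last exact/itv0yP.
    rewrite /phi /= patch_itv0y// in_itv/=.
    by move: ax xb; rewrite position_lt// position_ge// ltrBlDr lerBrDr => -> ->.
  rewrite lebesgue_measure_itv/= lte_fin; case: ltP => ab; last first.
    by rewrite set_itv_ge ?integral_set0// bnd_simp -leNgt position_ler// lerD2r.
  have pab : position (a - c) <= position (b - c).
    by rewrite position_ler// lerD2r ltW.
  have pa0 : 0 < position (a - c) by exact: position_gt0.
  rewrite integral_itv_obnd_cbnd; last first.
    apply/measurable_EFinP; apply: measurable_funS rV_measurable => //.
    by move=> x/=; rewrite !in_itv/= andbT => /andP[+ _]; exact: lt_trans.
  rewrite -/(travel_time r _ _) travel_timeE// !positionK//.
  by rewrite -EFinB; congr EFin; lra.
transitivity (\int[pushforward m phi]_s G s)%E; last first.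
  by apply: eq_measure_integral => A mA _; exact/esym/mE.
rewrite ge0_integral_pushforward//= preimage_setT.
rewrite (ge0_integral_density (mu := leb) (w := w))//; last first.
  exact: measurableT_comp.
rewrite [LHS]integral_mkcond; apply: eq_integral => x _.
by rewrite /phi /w !patchE; case: ifP => _; rewrite ?mule0.
Qed.

(** Both sides are the integral of H (position s) ds, by [integral_clock] with
    c = - t and c = 0. *)
Lemma integral_flow_back (t : R) (H : R -> \bar R) : 0 <= t ->
  measurable_fun setT H -> (forall x, 0 <= H x)%E ->
  (\int[leb]_(y in `]0%R, +oo[) (H (flow_back y t) * ((r y)^-1)%:E) =
   \int[leb]_(x in `]0%R, +oo[) (H x * ((r x)^-1)%:E))%E.
Proof.
move=> t0 mH H0.
have mG : measurable_fun [set: R] (H \o position).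
  apply: measurableT_comp => //; apply: continuous_measurable_fun.
  exact: position_continuous.
transitivity (\int[leb]_s H (position s))%E.
  rewrite -(integral_clock (- t) mG); last by move=> s; exact: H0.
  apply: eq_integral => y.
  by rewrite inE/= in_itv/= andbT => y0; rewrite flow_backE.
rewrite -(integral_clock 0 mG); last by move=> s; exact: H0.
apply: eq_integral => x.
by rewrite inE/= in_itv/= andbT => x0; rewrite /= addr0 clockK.
Qed.

(** * Finiteness of the growth function *)

Lemma growth_ge0 (t : R) : 0 <= t -> (0 <= growth r t)%E.
Proof.
move=> t0; apply: (@le_trans _ _ ((1 + flow_fwd 1 t) / (1 + 1))%:E).
  have y0 : 0 < flow_fwd 1 t by exact: flow_fwd_gt0.
  by rewrite lee_fin divr_ge0//; lra.
by apply: ereal_sup_ubound; exists 1 => //; exact/itv0yP.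
Qed.

Lemma le_growth (s t : R) : 0 <= s -> s <= t -> (growth r s <= growth r t)%E.
Proof.
move=> s0 st; apply: ge_ereal_sup => _ [x /itv0yP x0 <-].
apply: (@le_trans _ _ ((1 + flow_fwd x t) / (1 + x))%:E).
  rewrite lee_fin ler_pM2r ?invr_gt0 ?ltr_wpDl// lerD2l.
  by apply: le_flow_fwd.
by apply: ereal_sup_ubound; exists x => //; exact/itv0yP.
Qed.

(** As y(x,t) increases with t, [growth r] is nondecreasing; near t0 it is
    bounded by its value at t0 + 1. *)
Lemma growth_conditionP :
  growth_condition r <-> forall t : R, 0 <= t -> (growth r t < +oo)%E.
Proof.
split=> [[]//|g_lty]; split => // t0 t00.
have t1 : 0 <= t0 + 1 by rewrite addr_ge0.
rewrite /bounded_near; near=> M; rewrite /within/=; near=> t => /=.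
rewrite in_itv/= andbT => t_ge0.
rewrite ger0_norm ?fine_ge0 ?growth_ge0//.
apply: (@le_trans _ _ (fine (growth r (t0 + 1)))).
  apply: fine_le; rewrite ?ge0_fin_numE ?growth_ge0 ?g_lty//.
  apply: le_growth => //; near: t; apply: lt_le_nbhsl; rewrite ltrDl//.
by near: M; apply: nbhs_pinfty_ge; exact: num_real.
Unshelve. all: by end_near. Qed.

(** The derivative C / r(z) - 1 / z of C [clock] - ln is nonnegative for
    z > 1. *)
Lemma ln_sub_le_clock (C x y : R) : (forall z, 1 < z -> r z <= C * z) ->
  1 <= x -> x <= y -> ln y - ln x <= C * (clock y - clock x).
Proof.
move=> rC x1; rewrite le_eqVlt => /predU1P[<-|xy]; first by rewrite !subrr mulr0.
have x0 : 0 < x by exact: lt_le_trans x1.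
have dclock z : z \in `]x, y[ ->
    is_derive z 1 (C *: clock - @ln R) (C * (r z)^-1 - z^-1).
  rewrite in_itv/= => /andP[xz _]; have z0 := lt_trans x0 xz.
  have dc := is_derive_clock z0.
  have dl := is_derive1_ln z0.
  exact: is_deriveB.
have cf : {within `[x, y], continuous (C *: clock - @ln R)}.
  apply: continuous_in_subspaceT => z /set_mem/=; rewrite in_itv/= => /andP[xz _].
  have z0 := lt_le_trans x0 xz.
  apply: continuousB; last exact: continuous_ln.
  by apply: continuousZr; exact: clock_continuous.
have [c + fE] := MVT xy dclock cf.
rewrite in_itv/= => /andP[xc _].
have c1 : 1 < c by exact: le_lt_trans xc.
have c0 : 0 < c by exact: lt_trans c1.
have d0 : 0 <= C * (r c)^-1 - c^-1.
  by rewrite subr_ge0 ler_pdivlMr ?r_gt0// mulrC ler_pdivrMr// rC.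
have : 0 <= (C *: clock - @ln R) y - (C *: clock - @ln R) x.
  by rewrite fE mulr_ge0// subr_ge0 ltW.
rewrite [_ y](_ : _ = C * clock y - ln y)// [_ x](_ : _ = C * clock x - ln x)//.
lra.
Qed.

(** Let y = y(x,t). If y > 1, then getting from max(x,1) to y takes at most the
    time t, and [ln_sub_le_clock] gives y <= max(x,1) e^(C t). If y <= 1, then
    1 + y <= 2. *)
Lemma growth_lty_of_linear_bound (t : R) : 0 <= t ->
  (ereal_sup [set (r z / z)%:E | z in `]1%R, +oo[] < +oo)%E ->
  (growth r t < +oo)%E.
Proof.
move=> t0; set S := ereal_sup _ => S_lty.
have rS z : 1 < z -> ((r z / z)%:E <= S)%E.
  by move=> z1; apply: ereal_sup_ubound; exists z => //=; rewrite in_itv/= z1.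
have Sfin : S \is a fin_num.
  rewrite ge0_fin_numE//; apply: le_trans (rS 2 _); last by rewrite ltr1n.
  by rewrite lee_fin divr_ge0// ltW// r_gt0.
pose C := fine S.
have rC z : 1 < z -> r z <= C * z.
  move=> z1; have z0 : 0 < z by exact: lt_trans z1.
  by rewrite -ler_pdivrMr// -lee_fin fineK// rS.
have C0 : 0 <= C.
  have : 0 < r 2 by rewrite r_gt0.
  have : r 2 <= C * 2 by apply: rC; rewrite ltr1n.
  lra.
apply: (@le_lt_trans _ _ (2 + expR (C * t))%:E); last exact: ltry.
apply: ge_ereal_sup => _ [x /itv0yP x0 <-].
have x10 : 0 < 1 + x by lra.
rewrite lee_fin ler_pdivrMr//.
set y := flow_fwd x t.
have y0 : 0 < y by exact: flow_fwd_gt0.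
have e0 : 0 < expR (C * t) := expR_gt0 _.
have [y1|y1] := leP y 1; first by nra.
pose x' := Num.max x 1.
have x'1 : 1 <= x' by rewrite le_max lexx orbT.
have x'0 : 0 < x' by exact: lt_le_trans x'1.
have x'y : x' <= y by rewrite ge_max (ltW y1) andbT; exact: flow_fwd_ge.
have x'x : x' <= 1 + x by rewrite ge_max lerDl lerDr ltW//= ltW.
have yE : clock y = clock x + t by rewrite /y flow_fwdE// positionK.
have xx' : clock x <= clock x' by rewrite clock_ler// le_max lexx.
have yx' : y <= x' * expR (C * t).
  rewrite -[leLHS]lnK ?posrE// -[x' in leRHS]lnK ?posrE// -expRD ler_expR.
  rewrite -lerBlDl; apply: le_trans (ln_sub_le_clock rC x'1 x'y) _.
  by rewrite ler_wpM2l// yE; lra.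
nra.
Qed.

Section weighted_transport.
Variable alpha : R.
Local Notation mu := (weighted_measure alpha).

(** * The norm of the transport operators *)

(** Outside (0, +oo), where r is arbitrary, [U0 r t f] need not be
    measurable. *)
Definition U0_pos (t : R) (f : R -> R) : R -> R := U0 r t f \_ Rpos.

Definition weight_ratio (t : R) : R -> R :=
  (fun x => (1 + flow_fwd x t) `^ alpha / (1 + x) `^ alpha) \_ Rpos.

Lemma weight_ratio_ge0 (t x : R) : 0 <= weight_ratio t x.
Proof.
by rewrite /weight_ratio patchE; case: ifP => // _; rewrite divr_ge0 ?powR_ge0.
Qed.

Lemma flow_back_measurable (t : R) : 0 <= t ->
  measurable_fun Rpos (flow_back ^~ t).
Proof.
move=> t0; apply: open_continuous_measurable_fun; first exact: interval_open.
by move=> x /set_mem/itv0yP x0; exact: flow_back_continuous.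
Qed.

Lemma flow_fwd_measurable (t : R) : 0 <= t ->
  measurable_fun Rpos (flow_fwd ^~ t).
Proof.
move=> t0; apply: open_continuous_measurable_fun; first exact: interval_open.
by move=> x /set_mem/itv0yP x0; exact: flow_fwd_continuous.
Qed.

Lemma r_measurable : measurable_fun Rpos r.
Proof.
apply: open_continuous_measurable_fun; first exact: interval_open.
by move=> x /set_mem/itv0yP x0; exact: r_continuous_at.
Qed.

Lemma U0_pos_measurable (t : R) (f : R -> R) : 0 <= t ->
  measurable_fun setT f -> measurable_fun setT (U0_pos t f).
Proof.
move=> t0 mf; apply/(measurable_restrictT (U0 r t f)) => //.
apply: measurable_funM; last exact: rV_measurable.
apply: measurable_funM.
  apply: open_continuous_measurable_fun; first exact: interval_open.
  move=> x /set_mem/itv0yP x0.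
  apply: (@continuous_comp _ _ _ (flow_back ^~ t) r).
    exact: flow_back_continuous.
  by apply: r_continuous_at => //; exact: flow_back_gt0.
by apply: measurableT_comp => //; exact: flow_back_measurable.
Qed.

Lemma weight_forward_measurable (t : R) : 0 <= t ->
  measurable_fun Rpos (fun x => (1 + flow_fwd x t) `^ alpha).
Proof.
move=> t0; apply: (measurableT_comp (measurable_powR alpha)).
by apply: measurable_funD => //; exact: flow_fwd_measurable.
Qed.

Lemma weight_ratio_measurable (t : R) : 0 <= t ->
  measurable_fun setT (weight_ratio t).
Proof.
move=> t0.
apply/(measurable_restrictT
  (fun x => (1 + flow_fwd x t) `^ alpha / (1 + x) `^ alpha)) => //.
apply: measurable_funM; first exact: weight_forward_measurable.
rewrite (_ : (fun x => _) = (fun x : R => (1 + x) `^ (- alpha))); last first.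
  by apply/funext => x; rewrite powRN.
apply: (measurableT_comp (measurable_powR (- alpha))).
exact: measurable_funD.
Qed.

(** This is [integral_flow_back] for H x = r(x) h(x) (1 + y(x,t))^alpha: at
    x = X(y,t) the last factor is (1 + y)^alpha. *)
Lemma integral_U0_pos (t : R) (h : R -> R) : 0 <= t ->
  measurable_fun setT h -> (forall x, 0 <= h x) ->
  (\int[mu]_y (U0_pos t h y)%:E =
   \int[mu]_x (h x * weight_ratio t x)%:E)%E.
Proof.
move=> t0 mh h0.
have U0_ge0 y : 0 <= U0_pos t h y.
  rewrite /U0_pos patchE; case: ifPn => // /set_mem/itv0yP y0.
  by rewrite /U0 divr_ge0 ?mulr_ge0// ltW ?r_gt0//; exact: flow_back_gt0.
rewrite integral_weighted_measure; last 2 first.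
- by apply/measurable_EFinP; exact: U0_pos_measurable.
- by move=> y; rewrite lee_fin.
rewrite integral_weighted_measure; last 2 first.
- apply/measurable_EFinP; apply: measurable_funM => //.
  exact: weight_ratio_measurable.
- by move=> x; rewrite lee_fin mulr_ge0// weight_ratio_ge0.
pose H := (fun x => (r x * (h x * (1 + flow_fwd x t) `^ alpha))) \_ Rpos.
have H0 x : 0 <= H x.
  rewrite /H patchE; case: ifPn => // /set_mem/itv0yP x0.
  by rewrite !mulr_ge0 ?powR_ge0// ltW// r_gt0.
have mH : measurable_fun setT H.
  apply/(measurable_restrictT
    (fun x => (r x * (h x * (1 + flow_fwd x t) `^ alpha)))) => //.
  apply: measurable_funM; first exact: r_measurable.
  apply: measurable_funM; first exact: measurable_funTS.
  exact: weight_forward_measurable.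
transitivity
  (\int[leb]_(y in Rpos) ((EFin \o H) (flow_back y t) * ((r y)^-1)%:E))%E.
  apply: eq_integral => y /set_mem/itv0yP y0.
  have x0 := flow_back_gt0 t0 y0.
  rewrite /U0_pos patch_itv0y//= /H patch_itv0y// -!EFinM; congr EFin.
  by rewrite flow_backK// /U0; ring.
rewrite integral_flow_back//; last by apply/measurable_EFinP.
apply: eq_integral => x /set_mem/itv0yP x0.
rewrite /= /H /weight_ratio !patch_itv0y// -!EFinM; congr EFin.
have w0 : (1 + x) `^ alpha != 0 by rewrite gt_eqF// powR_gt0// ltr_wpDl.
have rx0 : r x != 0 by rewrite gt_eqF// r_gt0.
by field; rewrite w0 rx0.
Qed.

Lemma U0_posE (t : R) (f : R -> R) (y : R) : 0 < y ->
  U0_pos t f y = r (flow_back y t) * f (flow_back y t) / r y.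
Proof. by move=> y0; rewrite /U0_pos patch_itv0y. Qed.

Lemma U0_pos_le0 (t : R) (f : R -> R) (y : R) : y <= 0 -> U0_pos t f y = 0.
Proof.
move=> y0; rewrite /U0_pos patchE memNset//.
by rewrite itv0yP; apply/negP; rewrite -leNgt.
Qed.

Lemma U0_pos_ae (t : R) (f : R -> R) : U0_pos t f = U0 r t f %[ae mu].
Proof.
by apply: ae_weighted_measure => x x0 _; rewrite U0_posE.
Qed.

Lemma normr_U0_pos (t : R) (f : R -> R) (y : R) : 0 <= t ->
  `|U0_pos t f y| = U0_pos t (fun x => `|f x|) y.
Proof.
move=> t0; have [y0|y0] := ltP 0 y; last by rewrite !U0_pos_le0// normr0.
have x0 : 0 < flow_back y t by exact: flow_back_gt0.
rewrite !U0_posE// !normrM normfV.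
by rewrite (gtr0_norm (r_gt0 x0)) (gtr0_norm (r_gt0 y0)).
Qed.

Lemma integral_normr_U0_pos (t : R) (f : R -> R) : 0 <= t ->
  measurable_fun setT f ->
  (\int[mu]_y `|U0_pos t f y|%:E =
   \int[mu]_x (`|f x| * weight_ratio t x)%:E)%E.
Proof.
move=> t0 mf; rewrite -integral_U0_pos//; last exact: measurableT_comp.
by apply: eq_integral => y _; rewrite normr_U0_pos.
Qed.

(** By [integral_U0_pos], the image of f - g has norm 0 when f - g vanishes
    almost everywhere; thus U_0(t) acts on classes. *)
Lemma U0_pos_ae_eq (t : R) (f g : R -> R) : 0 <= t ->
  measurable_fun setT f -> measurable_fun setT g -> f = g %[ae mu] ->
  U0_pos t f = U0_pos t g %[ae mu].
Proof.
move=> t0 mf mg fg.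
pose k x := f x - g x.
have mk : measurable_fun setT k by exact: measurable_funB.
have mU : measurable_fun setT (EFin \o U0_pos t k).
  by apply/measurable_EFinP; exact: U0_pos_measurable.
have /(ae_eq_integral_abs mu measurableT mU) :
    (\int[mu]_x `|(EFin \o U0_pos t k) x| = 0)%E.
  transitivity (\int[mu]_x `|U0_pos t k x|%:E)%E => //.
  rewrite integral_normr_U0_pos// (ae_eq_integral (cst 0%E))//.
  - exact: integral0.
  - apply/measurable_EFinP; apply: measurable_funM.
      exact: measurableT_comp.
    exact: weight_ratio_measurable.
  - apply: (@filterS _ _ (ae_filter_ringOfSetsType mu) _ _ _ fg) => x fgx xT.
    by rewrite /k fgx// subrr normr0 mul0r.
apply: filterS => x /(_ I) [] /eqP + _.
have [x0|x0] := ltP 0 x; last by rewrite !U0_pos_le0.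
rewrite !U0_posE// => /eqP h; apply/eqP; rewrite -subr_eq0.
by rewrite -mulrBl -mulrBr h.
Qed.

Definition weight_sup (t : R) : \bar R :=
  ereal_sup [set ((1 + flow_fwd x t) `^ alpha / (1 + x) `^ alpha)%:E | x in Rpos].

Lemma le_weight_sup (t x : R) : 0 < x ->
  (((1 + flow_fwd x t) `^ alpha / (1 + x) `^ alpha)%:E <= weight_sup t)%E.
Proof. by move=> x0; apply: ereal_sup_ubound; exists x => //; exact/itv0yP. Qed.

Lemma weight_sup_ge0 (t : R) : (0 <= weight_sup t)%E.
Proof.
apply: le_trans (le_weight_sup t ltr01).
by rewrite lee_fin divr_ge0 ?powR_ge0.
Qed.

Lemma weight_ratio_le (t x : R) : ((weight_ratio t x)%:E <= weight_sup t)%E.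
Proof.
have [x0|x0] := ltP 0 x.
  by rewrite /weight_ratio patch_itv0y// le_weight_sup.
rewrite /weight_ratio patchE memNset ?weight_sup_ge0//.
by rewrite itv0yP; apply/negP; rewrite -leNgt.
Qed.

Lemma integral_U0_pos_le (t : R) (f : R -> R) : 0 <= t ->
  measurable_fun setT f ->
  (\int[mu]_y `|U0_pos t f y|%:E <= weight_sup t * \int[mu]_x `|f x|%:E)%E.
Proof.
move=> t0 mf; rewrite integral_normr_U0_pos//.
have mnf : measurable_fun setT (fun x => `|f x|) by exact: measurableT_comp.
rewrite -ge0_integralZl//; last 2 first.
- exact/measurable_EFinP.
- exact: weight_sup_ge0.
apply: ge0_le_integral => //.
- by move=> x _; rewrite lee_fin mulr_ge0// weight_ratio_ge0.
- apply/measurable_EFinP; apply: measurable_funM => //.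
  exact: weight_ratio_measurable.
- by apply: measurable_funeM; exact/measurable_EFinP.
- move=> x _; rewrite EFinM muleC.
  by rewrite lee_wpmul2r ?lee_fin// weight_ratio_le.
Qed.

Section given_operator.
Variable U : R -> X0 alpha -> X0 alpha.
Hypothesis UU0 : given_by_U0 r U.

Lemma given_by_U0_rep (t : R) (u : X0 alpha) : 0 <= t ->
  L1_rep (U t u) = U0_pos t (L1_rep u) %[ae mu].
Proof.
move=> t0; move: (UU0 t0 (L1_fun u)) (U0_pos_ae t (L1_rep u)).
rewrite L1_classK.
by apply: filterS2 => x h1 h2 xT; rewrite h1// h2.
Qed.

Lemma given_by_U0_norm (t : R) (u : X0 alpha) : 0 <= t ->
  (`|U t u|%:E = \int[mu]_y `|U0_pos t (L1_rep u) y|%:E)%E.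
Proof.
move=> t0; rewrite EFin_L1_norm; apply: ae_eq_integral => //.
- apply/measurable_EFinP; apply: measurableT_comp => //.
  exact: L1_rep_measurable.
- apply/measurable_EFinP; apply: measurableT_comp => //.
  by apply: U0_pos_measurable => //; exact: (L1_rep_measurable u).
by move: (given_by_U0_rep u t0); apply: filterS => x h xT; rewrite h.
Qed.

Lemma opnorm_le_weight_sup (t : R) : 0 <= t ->
  (opnorm (U t) <= weight_sup t)%E.
Proof.
move=> t0; apply: ge_ereal_sup => _ [u /= u1 <-].
rewrite given_by_U0_norm//.
apply: le_trans (integral_U0_pos_le t0 (L1_rep_measurable u)) _.
rewrite -EFin_L1_norm -[leRHS]mule1.
by apply: lee_wpmul2l; [exact: weight_sup_ge0|rewrite lee_fin].
Qed.

End given_operator.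

Hypothesis alpha_gt0 : 0 < alpha.

(** The test function is a multiple of the indicator of [a, b]. On this
    interval 1 + y(x,t) >= 1 + y(a,t), which bounds the norm of the image from
    below, whereas 1 + x <= 1 + b bounds the norm of the function from
    above. *)
Lemma weight_le_opnorm (U : R -> X0 alpha -> X0 alpha) (t a b : R) :
  given_by_U0 r U -> 0 <= t -> 0 < a -> a < b ->
  (((1 + flow_fwd a t) `^ alpha / (1 + b) `^ alpha)%:E <= opnorm (U t))%E.
Proof.
move=> UU0 t0 a0 ab; have b0 : 0 < b := lt_trans a0 ab.
have wb0 := weight_gt0 alpha b0.
have ab0 : 0 < b - a by rewrite subr_gt0.
(* This constant gives the test function a norm of at most 1. *)
pose c := ((1 + b) `^ alpha * (b - a))^-1.
have c0 : 0 < c by rewrite invr_gt0 mulr_gt0.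
have c_cont : continuous (cst c : R -> R) by move=> x; exact: cvg_cst.
pose f : R -> R := cst c \_ `[a, b].
pose F := Lfun_Sub (@lexx _ _ 1%E) (patch_itv_Lfun alpha_gt0 a0 ab c_cont).
have f0 x : 0 <= f x by rewrite /f patchE; case: ifP => // _; exact: ltW.
have fE x : a <= x <= b -> f x = c.
  by move=> axb; rewrite /f patchE mem_set//= in_itv.
have mf : measurable_fun setT f by exact: (@measurable_funPT _ _ _ _ F).
have v1 : `|L1_class F| <= 1.
  rewrite -lee_fin EFin_norm_class.
  apply: le_trans (_ : \int[mu]_x (f x)%:E <= _)%E.
    by apply: ge0_le_integral => // [||x _];
      [apply/measurable_EFinP; exact: measurableT_comp|
       exact/measurable_EFinP|rewrite lee_fin ger0_norm].
  apply: le_trans (integral_weighted_itv_le alpha_gt0 a0 ab _ _) _ => //.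
    by move=> x; exact: ltW.
  rewrite integral_itv_cst// -EFinM lee_fin [c * _]mulrC mulrA.
  by rewrite divff// gt_eqF// mulr_gt0.
apply: (@le_trans _ _ `|U t (L1_class F)|%:E%E); last first.
  by apply: ereal_sup_ubound; exists (L1_class F).
rewrite (given_by_U0_norm UU0)// integral_normr_U0_pos//; last first.
  exact: (L1_rep_measurable (L1_class F)).
have mw := weight_ratio_measurable t0.
rewrite (ae_eq_integral
  (fun x : measurableTypeR R => (f x * weight_ratio t x)%:E))//; last 3 first.
- apply/measurable_EFinP; apply: measurable_funM => //.
  by apply: measurableT_comp => //; exact: (L1_rep_measurable (L1_class F)).
- by apply/measurable_EFinP; exact: measurable_funM.
- apply: (@filterS _ _ (ae_filter_ringOfSetsType mu) _ _ _ (L1_classE F)).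
  by move=> x fx xT; rewrite fx// ger0_norm.
rewrite integral_weighted_measure; last 2 first.
- by apply/measurable_EFinP; exact: measurable_funM.
- by move=> x; rewrite lee_fin mulr_ge0// weight_ratio_ge0.
have mfw (E : set R) : measurable_fun E
    (fun x => ((f x * weight_ratio t x)%:E * ((1 + x) `^ alpha)%:E)%E).
  apply/measurable_EFinP; apply: measurable_funTS.
  by apply: measurable_funM; [exact: measurable_funM|exact: weight_measurable].
apply: (@le_trans _ _
    (\int[leb]_(x in `[a, b]) (c * (1 + flow_fwd a t) `^ alpha)%:E)%E).
  rewrite integral_itv_cst// lee_fin /c le_eqVlt; apply/orP; left; apply/eqP.
  have wb1 : (1 + b) `^ alpha != 0 by rewrite gt_eqF.
  have ba : b - a != 0 by rewrite gt_eqF.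
  by field; rewrite wb1 ba.
apply: (@le_trans _ _ (\int[leb]_(x in `[a, b])
    ((f x * weight_ratio t x)%:E * ((1 + x) `^ alpha)%:E))%E).
  apply: ge0_le_integral => //.
  - by move=> x _; rewrite lee_fin mulr_ge0 ?powR_ge0// ltW.
  - exact: mfw.
  move=> x /=; rewrite in_itv/= => axb; have /andP[ax _] := axb.
  have x0 : 0 < x by exact: lt_le_trans ax.
  rewrite fE// -EFinM lee_fin -mulrA ler_wpM2l ?(ltW c0)//.
  rewrite /weight_ratio patch_itv0y// divfK; last by rewrite gt_eqF// weight_gt0.
  by apply: le_weight => //; [exact: flow_fwd_gt0|exact: le_flow_fwd].
apply: ge0_subset_integral => //; first exact: mfw.
  by move=> x _; rewrite -EFinM lee_fin !mulr_ge0 ?powR_ge0 ?weight_ratio_ge0.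
by move=> x /=; rewrite !in_itv/= andbT => /andP[ax _]; exact: lt_le_trans ax.
Qed.

(** Let b decrease to a in [weight_le_opnorm]. *)
Lemma weight_sup_le_opnorm (U : R -> X0 alpha -> X0 alpha) (t : R) :
  given_by_U0 r U -> 0 <= t -> (weight_sup t <= opnorm (U t))%E.
Proof.
move=> UU0 t0; apply: ge_ereal_sup => _ [a /itv0yP a0 <-].
have [Mfin|] := ltP (opnorm (U t)) +oo%E; last first.
  by rewrite leye_eq => /eqP ->; rewrite leey.
have M_ge0 : (0 <= opnorm (U t))%E.
  apply: le_trans (weight_le_opnorm UU0 t0 a0 (_ : a < a + 1)).
    by rewrite lee_fin divr_ge0 ?powR_ge0.
  by rewrite ltrDl.
have : opnorm (U t) \is a fin_num by rewrite ge0_fin_numE.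
move/fineK => ME; rewrite -ME lee_fin ler_pdivrMr ?weight_gt0//.
apply: (@cvgr_to_ge _ a^'+ _ _
    (fun b => fine (opnorm (U t)) * (1 + b) `^ alpha)).
  apply: cvg_at_right_filter; apply: cvgMr.
  exact: weight_continuous.
near=> b; have ab : a < b by near: b; exact: nbhs_right_gt.
rewrite -ler_pdivrMr ?weight_gt0// ?(lt_trans a0)// -lee_fin ME.
exact: weight_le_opnorm.
Unshelve. all: by end_near. Qed.

Lemma opnormE (U : R -> X0 alpha -> X0 alpha) (t : R) :
  given_by_U0 r U -> 0 <= t -> opnorm (U t) = weight_sup t.
Proof.
move=> UU0 t0; apply/eqP; rewrite eq_le weight_sup_le_opnorm// andbT.
exact: opnorm_le_weight_sup.
Qed.

Lemma ratio_powR (x y : R) : 0 < x -> 0 < y ->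
  (1 + y) `^ alpha / (1 + x) `^ alpha = ((1 + y) / (1 + x)) `^ alpha.
Proof.
move=> x0 y0; have w0 : (1 + x) `^ alpha != 0 by rewrite gt_eqF// weight_gt0.
apply: (mulIf w0); rewrite divfK// -powRM ?divfK ?divr_ge0//; lra.
Qed.

(** The terms of the two suprema correspond to each other under the increasing
    bijection z |-> z^alpha of [0, +oo). *)
Lemma growth_lty (t : R) : 0 <= t ->
  (growth r t < +oo)%E <-> (weight_sup t < +oo)%E.
Proof.
move=> t0; have ratio_ge0 x : 0 < x -> 0 <= (1 + flow_fwd x t) / (1 + x).
  move=> x0; have y0 : 0 < flow_fwd x t by exact: flow_fwd_gt0.
  by rewrite divr_ge0//; lra.
split=> [g_lty|s_lty].
  have gfin : growth r t \is a fin_num.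
    by rewrite ge0_fin_numE// growth_ge0.
  apply: (@le_lt_trans _ _ (fine (growth r t) `^ alpha)%:E); last exact: ltry.
  apply: ge_ereal_sup => _ [x /itv0yP x0 <-].
  have y0 : 0 < flow_fwd x t by exact: flow_fwd_gt0.
  rewrite lee_fin ratio_powR//; apply: ge0_ler_powR.
  - exact: ltW.
  - by rewrite nnegrE ratio_ge0.
  - by rewrite nnegrE fine_ge0// growth_ge0.
  rewrite -lee_fin fineK//.
  by apply: ereal_sup_ubound; exists x => //; exact/itv0yP.
have sfin : weight_sup t \is a fin_num.
  by rewrite ge0_fin_numE// weight_sup_ge0.
apply: (@le_lt_trans _ _ (fine (weight_sup t) `^ alpha^-1)%:E); last exact: ltry.
apply: ge_ereal_sup => _ [x /itv0yP x0 <-].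
have y0 : 0 < flow_fwd x t by exact: flow_fwd_gt0.
rewrite lee_fin -[leLHS]powRr1 ?ratio_ge0//.
rewrite -[X in _ `^ X <= _](@divff _ alpha) ?gt_eqF//.
rewrite powRrM; apply: ge0_ler_powR.
- by rewrite invr_ge0 ltW.
- by rewrite nnegrE powR_ge0.
- by rewrite nnegrE fine_ge0// weight_sup_ge0.
by rewrite -ratio_powR// -lee_fin fineK// le_weight_sup.
Qed.

(** * Construction of the semigroup *)

(** [U0_pos_Lfun] provides the membership for t >= 0 when the weight ratios are
    bounded. *)
Definition U0_op (t : R) (u : X0 alpha) : X0 alpha :=
  if pselect (U0_pos t (L1_rep u) \in Lfun mu 1) is left Ut
  then L1_class (Lfun_Sub (@lexx _ _ 1%E) Ut) else 0.

Section semigroup.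
Hypothesis weight_sup_lty : forall t : R, 0 <= t -> (weight_sup t < +oo)%E.

Lemma U0_pos_Lfun (t : R) (u : X0 alpha) : 0 <= t ->
  U0_pos t (L1_rep u) \in Lfun mu 1.
Proof.
move=> t0; apply: Lfun1P.
  by apply: U0_pos_measurable => //; exact: (L1_rep_measurable u).
have mu' := L1_rep_measurable u.
apply: le_lt_trans
  (integral_U0_pos_le t0 mu') _.
by rewrite -EFin_L1_norm lte_mul_pinfty ?weight_sup_ge0 ?ltry// ge0_fin_numE
  ?weight_sup_lty ?weight_sup_ge0.
Qed.

Lemma U0_opE (t : R) (u : X0 alpha) : 0 <= t ->
  L1_rep (U0_op t u) = U0_pos t (L1_rep u) %[ae mu].
Proof.
move=> t0; rewrite /U0_op; case: pselect => [Ut|]; last first.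
  by move=> /(_ (U0_pos_Lfun u t0)).
exact: (L1_classE (Lfun_Sub (@lexx _ _ 1%E) Ut)).
Qed.

Lemma U0_op_given : given_by_U0 r U0_op.
Proof.
move=> t t0 f.
have mf : measurable_fun setT f by exact: (@measurable_funPT _ _ _ _ f).
have mc := L1_rep_measurable (L1_class f).
have := U0_pos_ae_eq t0 mc mf (L1_classE f).
move: (U0_opE (L1_class f) t0) (U0_pos_ae t f).
by apply: filterS3 => x h1 h2 h3 xT; rewrite h1// h3// h2.
Qed.

Lemma U0_op_linear (t : R) : 0 <= t -> linear (U0_op t).
Proof.
move=> t0 a u v; apply: L1_ext.
pose k x := a * L1_rep u x + L1_rep v x.
have mk : measurable_fun setT k.
  apply: measurable_funD; last exact: (L1_rep_measurable v).
  by apply: measurable_funM => //; exact: (L1_rep_measurable u).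
have kE : L1_rep (a *: u + v) = k %[ae mu].
  move: (L1_addE (a *: u) v) (L1_scaleE a u).
  apply: filterS2 => x h1 h2 xT.
  by rewrite [a *: u + v]/(L1_add (a *: u) v) h1// [a *: u]/(L1_scale a u) h2.
have mc := L1_rep_measurable (a *: u + v).
have kU := U0_pos_ae_eq t0 mc mk kE.
apply: filterS3 (filterI (U0_opE (a *: u + v) t0) kU)
  (filterI (U0_opE u t0) (U0_opE v t0))
  (filterI (L1_addE (a *: U0_op t u) (U0_op t v)) (L1_scaleE a (U0_op t u))).
move=> x [h5 h6] [h1 h2] [h3 h4] xT.
rewrite h5// h6// [_ + _]/(L1_add (a *: U0_op t u) (U0_op t v)) h3//.
rewrite [_ *: _]/(L1_scale a (U0_op t u)) h4// h1// h2//.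
have [x0|x0] := ltP 0 x; last by rewrite !U0_pos_le0// mulr0 addr0.
by rewrite !U0_posE// /k; ring.
Qed.

Lemma U0_op_norm_le (t : R) (u : X0 alpha) : 0 <= t ->
  `|U0_op t u| <= fine (weight_sup t) * `|u|.
Proof.
move=> t0; have sfin : weight_sup t \is a fin_num.
  by rewrite ge0_fin_numE ?weight_sup_lty ?weight_sup_ge0.
rewrite -lee_fin EFinM (fineK sfin).
rewrite (given_by_U0_norm U0_op_given)//.
rewrite EFin_L1_norm; apply: integral_U0_pos_le => //.
exact: (L1_rep_measurable u).
Qed.

Lemma U0_op_continuous (t : R) : 0 <= t -> continuous (U0_op t).
Proof.
move=> t0.
exact: continuous_of_bound (U0_op_linear t0) (fun u => U0_op_norm_le u t0).
Qed.

Lemma U0_op0 : U0_op 0 = id.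
Proof.
apply/funext => u; apply: L1_ext.
have pos : {ae mu, forall x, 0 < x}.
  exact: ae_weighted_measure.
move: (U0_opE u (lexx 0)) pos; apply: filterS2 => x h x0 xT.
rewrite h// U0_posE// flow_back0// mulrAC divff ?mul1r// gt_eqF//.
exact: r_gt0.
Qed.

Lemma U0_opD (s t : R) : 0 <= s -> 0 <= t ->
  U0_op (s + t) = U0_op s \o U0_op t.
Proof.
move=> s0 t0; have st0 : 0 <= s + t by rewrite addr_ge0.
apply/funext => u; apply: L1_ext => /=.
have m1 := L1_rep_measurable (U0_op t u).
have m2 := U0_pos_measurable t0 (L1_rep_measurable u).
have := U0_pos_ae_eq s0 m1 m2 (U0_opE u t0).
move: (U0_opE u st0) (U0_opE (U0_op t u) s0).
apply: filterS3 => x h1 h2 h3 xT; rewrite h1// h2// h3//.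
have [x0|x0] := ltP 0 x; last by rewrite !U0_pos_le0.
have z0 : 0 < flow_back x s by exact: flow_back_gt0.
rewrite !U0_posE// flow_backD//.
have rx0 : r x != 0 by rewrite gt_eqF// r_gt0.
have rz0 : r (flow_back x s) != 0 by rewrite gt_eqF// r_gt0.
by field; rewrite rx0 rz0.
Qed.

(** A nonnegative class is that of |f|, and U_0(t) commutes with absolute
    values. *)
Lemma U0_op_positive (t : R) : 0 <= t -> positive_operator (U0_op t).
Proof.
move=> t0 u u0; have m1 := L1_rep_measurable u.
have m2 : measurable_fun setT (fun x => `|L1_rep u x|) by exact: measurableT_comp.
have uE : L1_rep u = (fun x => `|L1_rep u x|) %[ae mu].
  by move: u0; apply: filterS => x ux xT; rewrite ger0_norm.
have := U0_pos_ae_eq t0 m1 m2 uE.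
move: (U0_opE u t0); apply: filterS2 => x h1 h2.
by rewrite h1// h2// -normr_U0_pos.
Qed.

(** * Strong continuity *)

Lemma flow_back_cvg (y : R) (t : R^nat) : 0 < y ->
  (forall n, 0 <= t n) -> t n @[n --> \oo] --> 0 ->
  flow_back y (t n) @[n --> \oo] --> y.
Proof.
move=> y0 t0 t_cvg; under eq_fun do rewrite flow_backE//.
have : position (clock y - t n) @[n --> \oo] --> position (clock y - 0).
  apply: continuous_cvg; first exact: position_continuous.
  by apply: cvgB => //; exact: cvg_cst.
by rewrite subr0 clockK.
Qed.

(** If X(y,t) is in [a, b] and t <= 1, then y is in [a, y(b,1)]. On this
    compact subset of (0, +oo) the function 1 / r is bounded, and r |h| is
    bounded on [a, b]. *)
Lemma U0_pos_patch_le (h : R -> R) (a b : R) : 0 < a -> a < b ->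
  continuous h -> exists C, 0 <= C /\ forall t y, 0 <= t -> t <= 1 ->
  `|U0_pos t (h \_ `[a, b]) y| <= C * \1_(`[a, flow_fwd b 1]%classic : set R) y.
Proof.
move=> a0 ab ch; have b0 := lt_trans a0 ab.
set b' := flow_fwd b 1.
have bb' : b <= b' by exact: flow_fwd_ge.
have ab' : a <= b' := le_trans (ltW ab) bb'.
have [||K HK] := @continuous_segment_bounded R (fun x => r x * `|h x|) a b.
- exact: ltW.
- apply: continuous_in_subspaceT => x /set_mem/=; rewrite in_itv/= => /andP[ax _].
  have x0 : 0 < x by exact: lt_le_trans ax.
  apply: cvgM; first exact: r_continuous_at.
  by apply: cvg_norm; exact: ch.
have [||Q HQ] := @continuous_segment_bounded R (fun x => (r x)^-1) a b'.
- exact: ab'.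
- apply: continuous_in_subspaceT => x /set_mem/=; rewrite in_itv/= => /andP[ax _].
  by apply: rV_continuous_at => //; exact: lt_le_trans ax.
have K0 : 0 <= K.
  apply: le_trans (HK a _); last by rewrite lexx ltW.
  by rewrite mulr_ge0// ltW// r_gt0.
have Q0 : 0 <= Q.
  apply: le_trans (HQ a _); last by rewrite lexx.
  by rewrite invr_ge0 ltW// r_gt0.
exists (K * Q); split; first by rewrite mulr_ge0.
move=> t y t0 t1; have C0 : 0 <= K * Q * \1_(`[a, b']%classic : set R) y.
  by rewrite mulr_ge0 ?mulr_ge0// indicE ler0n.
have [y0|y0] := ltP 0 y; last by rewrite U0_pos_le0// normr0.
rewrite U0_posE// patchE; case: ifPn => [/set_mem/=|_]; last first.
  by rewrite mulr0 mul0r normr0.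
rewrite in_itv/= => /andP[aX Xb].
have x0 : 0 < flow_back y t by exact: flow_back_gt0.
have ay : a <= y.
  move: aX; rewrite flow_back_ge//; apply: le_trans.
  exact: flow_fwd_ge.
have yb' : y <= b'.
  move: Xb; rewrite flow_back_le// => /le_trans; apply.
  exact: le_flow_fwd.
rewrite indicE mem_set/= ?in_itv/= ?ay// mulr1.
rewrite !normrM normfV (gtr0_norm (r_gt0 x0)) (gtr0_norm (r_gt0 y0)).
apply: ler_pM.
- by rewrite mulr_ge0// ltW// r_gt0.
- by rewrite invr_ge0 ltW// r_gt0.
- by apply: HK; rewrite aX.
- by apply: HQ; rewrite ay.
Qed.

(** Dominated convergence with the bound of [U0_pos_patch_le]; the convergence
    is pointwise off the two points a and b, where the truncated function may
    jump. *)
Lemma U0_pos_patch_cvg (h : R -> R) (a b : R) (t : R^nat) : 0 < a -> a < b ->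
  continuous h -> (forall n, 0 <= t n) -> (forall n, t n <= 1) ->
  t n @[n --> \oo] --> 0 ->
  (\int[mu]_y `|U0_pos (t n) (h \_ `[a, b]) y - (h \_ `[a, b]) y|%:E
     @[n --> \oo] --> 0)%E.
Proof.
move=> a0 ab ch t0 t1 t_cvg; set g := h \_ `[a, b].
have b0 := lt_trans a0 ab.
have mI (c d : R) : measurable (`[c, d]%classic : set R) by [].
have mg : measurable_fun setT g.
  apply/(measurable_restrictT h) => //; apply: measurable_funTS.
  exact: continuous_measurable_fun.
have [C [C0 gC]] := U0_pos_patch_le a0 ab ch.
set b' := flow_fwd b 1.
have ab' : a < b' by apply: lt_le_trans ab _; exact: flow_fwd_ge.
have mind : measurable_fun setT (fun y => C * \1_(`[a, b']%classic : set R) y).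
  by apply: measurable_funM => //; exact: measurable_indic.
have [|||||_ + _] := @dominated_convergence _ _ _ mu setT measurableT
  (fun n => EFin \o U0_pos (t n) g) (EFin \o g)
  (fun y => (C * \1_(`[a, b']%classic : set R) y)%:E).
- by move=> n; apply/measurable_EFinP; exact: U0_pos_measurable.
- exact/measurable_EFinP.
- have ne (c : R) : {ae mu, forall y, y != c}.
    exists [set c]; split => //; first exact: weighted_measure_set1.
    by move=> y /= /negP; rewrite negbK => /eqP.
  have pos : {ae mu, forall y : R, 0 < y} by exact: ae_weighted_measure.
  apply: (@filterS3 _ _ (ae_filter_ringOfSetsType mu)
    _ _ _ _ _ pos (ne a) (ne b)) => y y0 ya yb _.
  apply: cvg_EFin; first exact: nearW.
  rewrite (_ : g y = r y * g y / r y); last first.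
    by rewrite mulrAC divff ?mul1r// gt_eqF// r_gt0.
  have Xy := flow_back_cvg y0 t0 t_cvg.
  under eq_fun do rewrite /= U0_posE//.
  apply: cvgMl; apply: cvgM.
    by apply: continuous_cvg => //; exact: r_continuous_at.
  by apply: continuous_cvg => //; exact: patch_continuous.
- apply/integrableP; split; first exact/measurable_EFinP.
  apply: le_lt_trans (_ : \int[mu]_y ((cst C \_ `[a, b']) y)%:E < _)%E.
    rewrite le_eqVlt; apply/orP; left; apply/eqP; apply: eq_integral => y _.
    rewrite patchE indicE; case: ifP => _; last by rewrite mulr0 abse0.
    by rewrite mulr1 /= ger0_norm.
  have mC : measurable_fun setT (cst C : R -> R) by exact: measurable_cst.
  apply: le_lt_trans (integral_weighted_itv_le alpha_gt0 a0 ab' mC _) _ => //.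
  by rewrite integral_itv_cst// -EFinM ltry.
- apply: aeW => y n _; rewrite /= lee_fin; exact: gC.
by [].
Qed.

Lemma le_weight_sup_time (s t : R) : 0 <= s -> s <= t ->
  (weight_sup s <= weight_sup t)%E.
Proof.
move=> s0 st; apply: ge_ereal_sup => _ [x /itv0yP x0 <-].
apply: le_trans (le_weight_sup t x0).
rewrite lee_fin ler_pM2r ?invr_gt0 ?weight_gt0// le_weight//.
  exact: flow_fwd_gt0.
exact: le_flow_fwd.
Qed.

Lemma U0_op_dist_class (t : R) (g : R -> R) (gL : g \in Lfun mu 1) : 0 <= t ->
  let c := L1_class (Lfun_Sub (@lexx _ _ 1%E) gL) in
  (`|U0_op t c - c|%:E = \int[mu]_y `|U0_pos t g y - g y|%:E)%E.
Proof.
move=> t0 c; have mg : measurable_fun setT g.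
  by move: (gL); rewrite inE => /andP[]; rewrite inE.
have mc := L1_rep_measurable c.
have mUg := U0_pos_measurable t0 mg.
rewrite L1_distE; apply: ae_eq_integral => //.
- apply/measurable_EFinP; apply: measurableT_comp => //.
  by apply: measurable_funB => //; exact: (L1_rep_measurable (U0_op t c)).
- apply/measurable_EFinP; apply: measurableT_comp => //.
  exact: measurable_funB.
have cg := L1_classE (Lfun_Sub (@lexx _ _ 1%E) gL).
have Ug := U0_pos_ae_eq t0 mc mg cg.
have Uc := U0_opE c t0.
apply: (@filterS3 _ _ (ae_filter_ringOfSetsType mu) _ _ _ _ _ cg Ug Uc).
by move=> y h1 h2 h3 yT; rewrite h3// h2// h1.
Qed.

Lemma U0_op_class_cvg (h : R -> R) (a b : R) (a0 : 0 < a) (ab : a < b)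
    (ch : continuous h) :
  let c := L1_class
    (Lfun_Sub (@lexx _ _ 1%E) (patch_itv_Lfun alpha_gt0 a0 ab ch)) in
  `|U0_op t c - c| @[t --> 0^'+] --> 0.
Proof.
move=> c; apply/cvg_at_rightP => t [t_gt0 t_cvg].
(* Cutting the times at 1 changes finitely many terms and keeps the sequence
   in the range of [U0_pos_patch_cvg]. *)
pose s n := Num.min (t n) 1.
have s0 n : 0 <= s n by rewrite le_min ltW// ltW.
have s1 n : s n <= 1 by rewrite ge_min lexx orbT.
have ts : \forall n \near \oo, t n = s n.
  near=> n; rewrite /s min_l//; apply/ltW; near: n.
  by apply: cvgr_lt t_cvg _ _; exact: ltr01.
have s_cvg : s n @[n --> \oo] --> 0.
  by apply: cvg_trans t_cvg; apply: near_eq_cvg.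
have := U0_pos_patch_cvg a0 ab ch s0 s1 s_cvg.
under eq_fun do rewrite -(U0_op_dist_class (patch_itv_Lfun alpha_gt0 a0 ab ch))//.
move=> /fine_cvg; apply: cvg_trans; apply: near_eq_cvg.
by apply: filterS ts => n ->.
Unshelve. all: by end_near. Qed.

(** The operators are uniformly bounded for t <= 1, so convergence on the dense
    set of [weighted_approximation] is enough. *)
Lemma U0_op_strong (u : X0 alpha) : U0_op t u @[t --> 0^'+] --> u.
Proof.
apply/cvgrPdist_lt => e e0.
(* For t <= 1, replacing u by c costs |u - c| for u itself and at most
   weight_sup 1 times as much for its image. *)
pose M := fine (weight_sup 1) + 2.
have M0 : 0 < M by rewrite ltr_wpDl// fine_ge0// weight_sup_ge0.
have eM0 : 0 < e / 2 / M by rewrite !divr_gt0.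
have mu' := L1_rep_measurable u.
have fu : (\int[mu]_x `|L1_rep u x|%:E < +oo)%E by rewrite -EFin_L1_norm ltry.
have [a [b [h [a0 ab ch uh]]]] := weighted_approximation alpha_gt0 mu' fu eM0.
pose G := Lfun_Sub (@lexx _ _ 1%E) (patch_itv_Lfun alpha_gt0 a0 ab ch).
pose c := L1_class G.
have uc : `|u - c| < e / 2 / M.
  rewrite -lte_fin L1_distE; apply: le_lt_trans uh.
  rewrite le_eqVlt; apply/orP; left; apply/eqP; apply: ae_eq_integral => //.
  - apply/measurable_EFinP; apply: measurableT_comp => //.
    by apply: measurable_funB => //; exact: L1_rep_measurable.
  - apply/measurable_EFinP; apply: measurableT_comp => //.
    by apply: measurable_funB => //; exact: (@measurable_funPT _ _ _ _ G).
  apply: (@filterS _ _ (ae_filter_ringOfSetsType mu) _ _ _ (L1_classE G)).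
  by move=> x hx xT; rewrite hx.
have e20 : 0 < e / 2 by rewrite divr_gt0.
have /cvgrPdist_lt/(_ _ e20) c_cvg := U0_op_class_cvg a0 ab ch.
near=> t.
have t0 : 0 <= t by apply/ltW; near: t; exact: nbhs_right_gt.
have t1 : t <= 1 by near: t; exact: nbhs_right_le.
have ct : `|U0_op t c - c| < e / 2.
  suff : `|0 - `|U0_op t c - c| | < e / 2 by rewrite sub0r normrN normr_id.
  by near: t.
have Uuc : `|U0_op t u - U0_op t c| <= fine (weight_sup 1) * `|u - c|.
  have -> : U0_op t u - U0_op t c = U0_op t (u - c).
    rewrite [u - c]addrC -(scaleN1r c) U0_op_linear//.
    by rewrite scaleN1r addrC.
  apply: le_trans (U0_op_norm_le _ t0) _.
  rewrite ler_wpM2r//; apply: fine_le; last exact: le_weight_sup_time.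
    by rewrite ge0_fin_numE ?weight_sup_ge0 ?weight_sup_lty.
  by rewrite ge0_fin_numE ?weight_sup_ge0 ?weight_sup_lty.
have -> : u - U0_op t u = (u - c) - (U0_op t c - c) - (U0_op t u - U0_op t c).
  by rewrite opprB addrA subrK opprB addrA subrK.
apply: le_lt_trans (ler_normB _ _) _.
apply: le_lt_trans (lerD (ler_normB _ _) Uuc) _.
have uc0 : 0 <= `|u - c| by [].
move: uc; rewrite ltr_pdivlMr// /M => uc.
nra.
Unshelve. all: by end_near. Qed.

End semigroup.

Lemma U0_semigroup_of_growth :
  (forall t, 0 <= t -> (growth r t < +oo)%E) ->
  U0_positive_C0_semigroup r U0_op.
Proof.
move=> g_lty.
have s_lty t : 0 <= t -> (weight_sup t < +oo)%E.
  by move=> t0; apply/growth_lty => //; exact: g_lty.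
split; first exact: U0_op_given.
- split.
  + by move=> t t0; exact: U0_op_linear.
  + by move=> t t0; exact: U0_op_continuous.
  + exact: U0_op0.
  + by move=> s t s0 t0; exact: U0_opD.
  + by move=> u; exact: U0_op_strong.
- by move=> t t0; exact: U0_op_positive.
Qed.

(** A continuous linear operator has finite norm, and the norm of U t is given
    by [opnormE]. *)
Lemma growth_lty_of_semigroup (U : R -> X0 alpha -> X0 alpha) (t : R) :
  U0_positive_C0_semigroup r U -> 0 <= t -> (growth r t < +oo)%E.
Proof.
move=> [UU0 C0U _] t0.
apply/(growth_lty t0); rewrite -(opnormE UU0 t0).
exact: opnorm_lty (C0_linear C0U t0) (C0_bounded C0U t0).
Qed.

End weighted_transport.
End transport.

Theorem theorem4p2 (R : realType) (alpha : R) (r : R -> R)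
  (alpha_gt0 : 0 < alpha)
  (r_cont : {in `]0, +oo[, continuous r})
  (r_gt0 : forall x : R, 0 < x -> 0 < r x)
  (r_int0 : (\int[lebesgue_measure]_(tau in `]0%R, 1%R[) ((r tau)^-1)%:E
             = +oo)%E)
  (r_intoo : (\int[lebesgue_measure]_(tau in `]1%R, +oo[) ((r tau)^-1)%:E
              = +oo)%E) :
  [/\ (* r(X(y,t)) / r(y) is the partial derivative of X in y *)
      forall t y : R, 0 <= t -> 0 < y ->
        derivable (fun z => flow_back r z t) y 1 /\
        forall f : R -> R,
          U0 r t f y =
          f (flow_back r y t) * derive1 (fun z => flow_back r z t) y,
      (exists U : R -> X0 alpha -> X0 alpha, U0_positive_C0_semigroup r U) <->
        growth_condition r,
      forall U : R -> X0 alpha -> X0 alpha, U0_positive_C0_semigroup r U ->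
        forall t : R, 0 <= t ->
        opnorm (U t) =
        ereal_sup [set ((1 + flow_fwd r x t) `^ alpha / (1 + x) `^ alpha)%:E
                  | x in `]0, +oo[] &
      (ereal_sup [set (r z / z)%:E | z in `]1%R, +oo[] < +oo)%E ->
        exists U : R -> X0 alpha -> X0 alpha, U0_positive_C0_semigroup r U].
Proof.
split.
- move=> t y t0 y0.
  have [dX XE] := is_derive_flow_back r_cont r_gt0 r_int0 r_intoo t0 y0.
  split => // f; rewrite derive1E XE /U0; ring.
- split=> [[U semiU]|[g_lty _]].
    apply/growth_conditionP => // t t0.
    exact: growth_lty_of_semigroup semiU t0.
  exists (@U0_op R r alpha); exact: U0_semigroup_of_growth.
- by move=> U [UU0 _ _] t t0; exact: opnormE.
- move=> r_lin; exists (@U0_op R r alpha).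
  apply: U0_semigroup_of_growth => // t t0.
  exact: growth_lty_of_linear_bound.
Qed.
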